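(* For every integer $n \geq 10$, $$d_{W}\left( \sqrt{\frac{1-\alpha^2}{1+ \alpha^2}}\, \sqrt{n}\, \theta_n , \, \mathcal{N}(0,1) \right) \leq \frac{\sqrt{2/\pi} \, C_{4}(\alpha) + C_{6}(\alpha)}{\sqrt{n}},$$ where $$C_{6}(\alpha) := \left(4 \left(2 \sqrt{2/\pi} + 1 \right)^{4} \sqrt{ \frac{1- \alpha^2}{1+ \alpha^2} } + 2 \left(2 \sqrt{2/\pi} + 1 \right)^{2} \frac{1- \alpha^2}{\sqrt{1+ \alpha^2}} \right) \left( C_{5}(\alpha) \right)^{1/4} \left[ \frac{2(1+\alpha^2)}{1-\alpha^2} + \frac{ (1- \alpha^2)^2 C_{1}(\alpha)^2}{10} + \frac{(1-\alpha^2)^2 C_2(\alpha) }{5} \right]^{1/2}.$$ In particular, $\sqrt{n}\, \theta_n$ converges in distribution to $\mathcal{N}\left( 0, (1+ \alpha^2)/(1- \alpha^2) \right)$ as $n \rightarrow \infty$.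
   Context: Let $\alpha\in\mathbb{R}$ with $|\alpha|<1$, and let $\xi_1,\xi_2,\dots,\eta_1,\eta_2,\dots$ be independent standard normal random variables. Define $X_0=Y_0=0$ and $X_n=\alpha X_{n-1}+\xi_n$, $Y_n=\alpha Y_{n-1}+\eta_n$ for $n\ge 1$. Put $Z_{11}^n=\frac1n\sum_{i=1}^n X_i^2-\frac1{n^2}\left(\sum_{i=1}^n X_i\right)^2$, $Z_{22}^n=\frac1n\sum_{i=1}^n Y_i^2-\frac1{n^2}\left(\sum_{i=1}^n Y_i\right)^2$, $Z_{12}^n=\frac1n\sum_{i=1}^n X_iY_i-\frac1{n^2}\left(\sum_{i=1}^n X_i\right)\left(\sum_{i=1}^n Y_i\right)$, and $\theta_n=Z_{12}^n/\sqrt{Z_{11}^nZ_{22}^n}$ (the empirical correlation). $d_W(X,Y)=\sup_{f}|Ef(X)-Ef(Y)|$, supremum over all $f:\mathbb{R}\to\mathbb{R}$ Lipschitz with constant $\le 1$ (Wasserstein distance between laws); $\mathcal N(0,1)$ stands for a standard normal random variable. Constants: $C_1(\alpha)=\frac{\alpha^2+(1+\alpha)^2}{(1-\alpha^2)^2}+\frac{4|\alpha|+5\alpha^2}{(1-\alpha)^2(1-\alpha^2)}$; $C_2(\alpha)=\frac{4}{(1-\alpha^2)^3}\sup_{m\ge1}m\alpha^{2m+2}+\frac{4\alpha^2+\alpha^4}{(1-\alpha^2)^4}+\frac{8}{(1-\alpha)^2(1-\alpha^2)}+\frac{16|\alpha|}{(1-|\alpha|)(1-\alpha)^2(1-\alpha^2)}+\frac{16}{(1-\alpha)^4}$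 (sup over positive integers $m$); $C_3(\alpha)=\left(\frac{2^{4/3}}{(1-\alpha^2)^{4/3}(1-|\alpha|^{4/3})}+\frac{16}{(1-\alpha)^{8/3}}\right)^3$; $C_4(\alpha)=\frac{(1-\alpha^2)^3}{1+\alpha^2}\sqrt{C_2(\alpha)^2+C_3(\alpha)}$; $C_5(\alpha)=3^4\left(\frac{1+\alpha^2}{(1-\alpha^2)^3}+\frac{C_2(\alpha)}{10}\right)^2$. *)

(* Defs.v *)
From HB Require Import structures.
From mathcomp Require Import all_boot all_order all_algebra finmap.
From mathcomp Require Import all_classical all_reals all_analysis.
From mathcomp Require Import measurable_realfun.

Set Implicit Arguments.
Unset Strict Implicit.
Unset Printing Implicit Defensive.

Import Order.TTheory GRing.Theory Num.Theory.
Import numFieldNormedType.Exports.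

Local Open Scope classical_set_scope.
Local Open Scope ring_scope.

Definition mutually_independent (R : realType) (d : measure_display)
    (T : measurableType d) (P : probability T R) (I : choiceType)
    (X : I -> {RV P >-> R}) : Prop :=
  forall (F : {fset I}) (B : I -> set R),
    (forall i, i \in F -> measurable (B i)) ->
    P (\bigcap_(i in [set` F]) (X i @^-1` B i)) =
    (\prod_(i <- F) P (X i @^-1` B i))%E.

(* As in [normal_prob], the second parameter is the standard deviation. *)
Definition normal_rv (R : realType) (d : measure_display)
    (T : measurableType d) (P : probability T R) (m s : R)
    (X : {RV P >-> R}) : Prop :=
  forall A : set R, measurable A -> distribution P X A = normal_prob m s A.

Definition wasserstein (R : realType) (d d' : measure_display)
    (T : measurableType d) (T' : measurableType d')
    (P : probability T R) (Q : probability T' R)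
    (X : {RV P >-> R}) (Y : {RV Q >-> R}) : \bar R :=
  ereal_sup [set (`| 'E_P[f \o X] - 'E_Q[f \o Y] |)%E
            | f in [set f : R -> R | 1.-lipschitz f]].

Definition cvg_in_distribution (R : realType) (d d' : measure_display)
    (T : measurableType d) (T' : measurableType d')
    (P : probability T R) (Q : probability T' R)
    (X : nat -> {RV P >-> R}) (Y : {RV Q >-> R}) : Prop :=
  forall f : R -> R, continuous f -> bounded_fun f ->
    ('E_P[f \o X n])%E @[n --> \oo] --> ('E_Q[f \o Y])%E.

Section empirical_correlation.
Context (R : realType) (d : measure_display) (T : measurableType d).

(* The noise is numbered from 0: [e i] is the innovation entering at time
   [i.+1]. *)
Fixpoint ar1 (alpha : R) (e : nat -> T -> R) (n : nat) : T -> R :=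
  if n is m.+1 then fun w => alpha * ar1 alpha e m w + e m w else fun=> 0.

Definition empirical_cov (n : nat) (X Y : nat -> T -> R) (w : T) : R :=
  n%:R^-1 * (\sum_(1 <= i < n.+1) X i w * Y i w)
  - (n%:R ^+ 2)^-1 * ((\sum_(1 <= i < n.+1) X i w) *
                      (\sum_(1 <= i < n.+1) Y i w)).

Definition empirical_corr (alpha : R) (xi eta : nat -> {mfun T >-> R})
    (n : nat) (w : T) : R :=
  let X := ar1 alpha xi in
  let Y := ar1 alpha eta in
  empirical_cov n X Y w /
  Num.sqrt (empirical_cov n X X w * empirical_cov n Y Y w).

Lemma measurable_ar1 (alpha : R) (e : nat -> {mfun T >-> R}) (n : nat) :
  measurable_fun [set: T] (ar1 alpha e n).
Proof.
elim: n => [|n IHn] /=; first exact: measurable_cst.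
by apply: measurable_funD => //; exact: measurable_funM.
Qed.

Lemma measurable_empirical_cov (n : nat) (X Y : nat -> T -> R) :
  (forall i, measurable_fun [set: T] (X i)) ->
  (forall i, measurable_fun [set: T] (Y i)) ->
  measurable_fun [set: T] (empirical_cov n X Y).
Proof.
move=> mX mY; apply: measurable_funB; apply: measurable_funM => //.
  by apply: measurable_sum => i; exact: measurable_funM.
by apply: measurable_funM; exact: measurable_sum.
Qed.

Lemma measurable_empirical_corr (alpha : R) (xi eta : nat -> {mfun T >-> R})
    (n : nat) : measurable_fun [set: T] (empirical_corr alpha xi eta n).
Proof.
have mX := measurable_ar1 alpha xi; have mY := measurable_ar1 alpha eta.
apply: measurable_funM; first exact: measurable_empirical_cov.
set q := fun w => empirical_cov n (ar1 alpha xi) (ar1 alpha xi) w *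
                  empirical_cov n (ar1 alpha eta) (ar1 alpha eta) w.
have mq : measurable_fun [set: T] (fun w => Num.sqrt (q w)).
  apply: (measurableT_comp (f := @Num.sqrt R)).
    by apply: continuous_measurable_fun => x; exact: sqrt_continuous.
  by apply: measurable_funM; exact: measurable_empirical_cov.
rewrite (_ : (fun _ => _) = fun w => Num.sqrt (q w) `^ (-1)).
  exact: (measurableT_comp (measurable_powR (-1)) mq).
by apply/funext => w; rewrite powR_inv1// sqrtr_ge0.
Qed.

HB.instance Definition _ (alpha : R) (xi eta : nat -> {mfun T >-> R})
    (n : nat) := isMeasurableFun.Build _ _ _ _ (empirical_corr alpha xi eta n)
  (measurable_empirical_corr alpha xi eta n).

End empirical_correlation.

Section constants.
Context (R : realType).
Implicit Types alpha : R.

Definition C1 alpha : R :=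
  (alpha ^+ 2 + (1 + alpha) ^+ 2) / (1 - alpha ^+ 2) ^+ 2
  + (4 * `|alpha| + 5 * alpha ^+ 2) / ((1 - alpha) ^+ 2 * (1 - alpha ^+ 2)).

Definition C2 alpha : R :=
  4 / (1 - alpha ^+ 2) ^+ 3
    * sup [set m%:R * alpha ^+ (2 * m + 2) | m in [set m : nat | (1 <= m)%N]]
  + (4 * alpha ^+ 2 + alpha ^+ 4) / (1 - alpha ^+ 2) ^+ 4
  + 8 / ((1 - alpha) ^+ 2 * (1 - alpha ^+ 2))
  + 16 * `|alpha| /
      ((1 - `|alpha|) * (1 - alpha) ^+ 2 * (1 - alpha ^+ 2))
  + 16 / (1 - alpha) ^+ 4.

Definition C3 alpha : R :=
  (2 `^ (4 / 3)
     / ((1 - alpha ^+ 2) `^ (4 / 3) * (1 - `|alpha| `^ (4 / 3)))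
   + 16 / (1 - alpha) `^ (8 / 3)) ^+ 3.

Definition C4 alpha : R :=
  (1 - alpha ^+ 2) ^+ 3 / (1 + alpha ^+ 2)
  * Num.sqrt (C2 alpha ^+ 2 + C3 alpha).

Definition C5 alpha : R :=
  3 ^+ 4 * ((1 + alpha ^+ 2) / (1 - alpha ^+ 2) ^+ 3 + C2 alpha / 10) ^+ 2.

Definition C6 alpha : R :=
  (4 * (2 * Num.sqrt (2 / pi) + 1) ^+ 4
     * Num.sqrt ((1 - alpha ^+ 2) / (1 + alpha ^+ 2))
   + 2 * (2 * Num.sqrt (2 / pi) + 1) ^+ 2
     * ((1 - alpha ^+ 2) / Num.sqrt (1 + alpha ^+ 2)))
  * C5 alpha `^ (1 / 4)
  * Num.sqrt (2 * (1 + alpha ^+ 2) / (1 - alpha ^+ 2)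
              + (1 - alpha ^+ 2) ^+ 2 * C1 alpha ^+ 2 / 10
              + (1 - alpha ^+ 2) ^+ 2 * C2 alpha / 5).

End constants.

(* Main.v *)
Require Import Defs.
From HB Require Import structures.
From mathcomp Require Import all_boot all_order all_algebra finmap ring lra zify.
From mathcomp Require Import all_classical all_reals all_analysis.
From mathcomp Require Import measurable_realfun.

Set Implicit Arguments.
Unset Strict Implicit.
Unset Printing Implicit Defensive.

Import Order.TTheory GRing.Theory Num.Theory.
Import numFieldNormedType.Exports.

Local Open Scope classical_set_scope.
Local Open Scope ring_scope.

(* Write theta = Zxy / S with S = sqrt (Zxx Zyy), and let A be the matrix for
   which n Zxx and n Zxy are x^T A x and x^T A y, x and y being the innovations
   of the two series.

   Given x, the variable n Zxy is centered Gaussian with variance |A x|^2, so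
   that, suitably normalized, it has the law of sqrt V * N with N standard
   normal and independent of V = |A x|^2 / (n tau^2),
   tau^2 = (1 + alpha^2) / (1 - alpha^2)^3.  Hence its Wasserstein distance to
   N is at most E|sqrt V - 1| <= E|V - 1|.  Replacing S by its limit
   1 / (1 - alpha^2) costs an error which is quadratic in Zxy and in the
   fluctuations of Zxx and Zyy.  All that remains are second moments of
   quadratic forms in independent normal variables, controlled by the trace,
   the Hilbert-Schmidt norm and the operator norm of A.  This gives the bound
   106 tau / sqrt n, and the constant C6 alone is at least 192 tau. *)

(** * Gaussian integrals *)

Section gaussian.
Context (R : realType).
Local Notation mu := (@lebesgue_measure R).
Local Notation gam := (@normal_prob R 0 1).
Implicit Types (a b m s x y : R) (f : R -> \bar R).

(** Uniformity in alpha shapes the estimates. The final bound must be proportional to [tau], however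
    close |alpha| is to 1, so operator norms, traces and Hilbert-Schmidt norms are all bounded
    through powers of 1/v, v = 1 - alpha^2, and surplus powers are absorbed by v^3 tau^2 = 1 +
    alpha^2 >= 1. Numerical factors have slack (106 against 192), so moments may be crude: the
    fourth moment is bounded by 5, variances of quadratic forms by twice their value.

    Conditioning on x uses no conditional expectation. The innovations form one sequence, and
    Fubini's theorem over the sigma-algebra of its first variables freezes the past and integrates
    the next variable against the normal law. Applied one variable at a time, the same device gives
    the moments of linear and quadratic forms, so only one-variable Gaussian integrals are ever
    needed.

    For E|V - 1| an upper bound on the Hilbert-Schmidt norm of A is not enough: the mean of V must
    be close to 1. The squared norm is therefore found up to an error bounded in n, by passing from
    L^T L to L L^T, whose entries are explicit (L maps innovations to the path). *)

Definition affine a b : measurableTypeR R -> measurableTypeR R :=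
  fun x => a * x + b.

Lemma measurable_affine a b :
  measurable_fun [set: measurableTypeR R] (affine a b).
Proof. by apply: measurable_funD => //; exact: measurable_funM. Qed.

HB.instance Definition _ a b :=
  isMeasurableFun.Build _ _ _ _ (affine a b) (measurable_affine a b).

(** Lebesgue measure is determined by its values on the intervals []u, w]]. The sign of [a] matters
    because a negative factor reverses the interval and moves its closed end. *)
Lemma lebesgue_measure_affine a b (A : set (measurableTypeR R)) :
  a != 0 -> measurable A ->
  (`|a|%R%:E * pushforward mu (affine a b) A = mu A)%E.
Proof.
move=> a0 mA.
have -> : (`|a|%R%:E * pushforward mu (affine a b) A =
    mscale (`|a|%:nng)%R (pushforward mu (affine a b)) A)%E by [].
apply/esym/lebesgue_measure_unique => // _ [[u w]] /= _ <-.
rewrite /mscale /= /pushforward /= /affine.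
have [ua|ua|ea] := ltgtP a 0; last by rewrite ea eqxx in a0.
  have -> : (fun x => a * x + b) @^-1` `]u, w]%classic =
      `[(w - b) / a, (u - b) / a[%classic.
    apply/seteqP; split => x /=; rewrite !in_itv /= => /andP[h1 h2]; apply/andP; split.
    - by rewrite ler_ndivrMr //; lra.
    - by rewrite ltr_ndivlMr //; lra.
    - by move: h2; rewrite ltr_ndivlMr //; lra.
    - by move: h1; rewrite ler_ndivrMr //; lra.
  rewrite !lebesgue_measure_itv /= !lte_fin ltr_ndivlMr // divfK //.
  rewrite ltrD2r; case: ifPn => _; last by rewrite mule0.
  rewrite -!EFinB -EFinM; congr EFin.
  by rewrite ler0_norm ?ltW//; field.
have -> : (fun x => a * x + b) @^-1` `]u, w]%classic =
      `](u - b) / a, (w - b) / a]%classic.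
  apply/seteqP; split => x /=; rewrite !in_itv /= => /andP[h1 h2]; apply/andP; split.
  - by rewrite ltr_pdivrMr //; lra.
  - by rewrite ler_pdivlMr //; lra.
  - by move: h1; rewrite ltr_pdivrMr //; lra.
  - by move: h2; rewrite ler_pdivlMr //; lra.
rewrite !lebesgue_measure_itv /= !lte_fin ltr_pdivrMr // divfK //.
rewrite ltrD2r; case: ifPn => _; last by rewrite mule0.
rewrite -!EFinB -EFinM; congr EFin.
by rewrite ger0_norm ?ltW//; field.
Qed.

Lemma ge0_integral_affine a b f : a != 0 -> measurable_fun [set: R] f ->
  (forall x, 0 <= f x)%E ->
  (\int[mu]_x f x = `|a|%:E * \int[mu]_x f (a * x + b)%R)%E.
Proof.
move=> a0 mf f0.
have := @ge0_integral_pushforward _ _ (measurableTypeR R) (measurableTypeR R) R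
   _ (measurable_affine a b) mu setT f measurableT mf (fun y _ => f0 y).
rewrite preimage_setT /= => <-.
rewrite -(ge0_integral_mscale (pushforward mu (affine a b)) measurableT
  (`|a|%:nng)%R)//.
by apply: eq_measure_integral => A mA _; rewrite -[LHS](lebesgue_measure_affine b a0 mA).
Qed.

Lemma normal_pdf1E m s x : s != 0 -> normal_pdf m s x = normal_peak s * normal_fun m s x.
Proof. by move=> s0; rewrite normal_pdfE. Qed.

Lemma normal_peakE s : normal_peak s = `|s|^-1 * (Num.sqrt (pi *+ 2))^-1.
Proof. by rewrite /normal_peak -mulrnAr sqrtrM ?sqr_ge0// sqrtr_sqr invfM. Qed.

(** The Radon-Nikodym derivative agrees almost everywhere with [normal_pdf], both having the same
    integral over every measurable set. *)
Lemma ge0_integral_normal m s f : measurable_fun [set: R] f ->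
  (forall x, 0 <= f x)%E ->
  (\int[normal_prob m s]_x f x = \int[mu]_x (f x * (normal_pdf m s x)%:E))%E.
Proof.
move=> mf f0.
have dom := normal_prob_dominates m s.
rewrite -(Radon_Nikodym_SigmaFinite.change_of_variables dom)//.
apply: ae_eq_integral => //.
- apply: emeasurable_funM => //; apply: (measurable_int mu).
  exact: Radon_Nikodym_SigmaFinite.f_integrable.
- apply: emeasurable_funM => //=; apply/measurable_EFinP.
  exact: measurable_normal_pdf.
- apply: ae_eqe_mul2l => /=.
  apply: integral_ae_eq => //=.
  + exact: Radon_Nikodym_SigmaFinite.f_integrable.
  + by apply/measurable_EFinP; exact: measurable_normal_pdf.
  + move=> E _ mE.
    by rewrite -(Radon_Nikodym_SigmaFinite.f_integral dom).
Qed.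

(** The Jacobian |s| cancels the |s|^-1 of the peak. Negative [s] is allowed, which later yields the
    symmetry of the normal law. *)
Lemma ge0_integral_gauss_affine m s f : s != 0 -> measurable_fun [set: R] f ->
  (forall x, 0 <= f x)%E ->
  (\int[gam]_x f (m + s * x)%R = \int[normal_prob m s]_x f x)%E.
Proof.
move=> s0 mf f0.
rewrite [LHS]ge0_integral_normal//; last first.
  by apply: measurableT_comp => //; apply: measurable_funD => //; exact: measurable_funM.
rewrite [RHS]ge0_integral_normal; [|exact: mf|exact: f0].
apply/esym; etransitivity.
  apply: (@ge0_integral_affine s m (fun x => f x * (normal_pdf m s x)%:E)%E s0).
    apply: emeasurable_funM => //=; apply/measurable_EFinP.
    exact: measurable_normal_pdf.
  by move=> x; rewrite mule_ge0// lee_fin normal_pdf_ge0.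
rewrite -ge0_integralZl//; last first.
  - by move=> x _; rewrite mule_ge0// lee_fin normal_pdf_ge0.
  - apply: emeasurable_funM => //=.
      apply: (measurableT_comp mf).
      by apply: measurable_funD => //; exact: measurable_funM.
    apply/measurable_EFinP; apply: (measurableT_comp (measurable_normal_pdf m s)).
    by apply: measurable_funD => //; exact: measurable_funM.
apply: eq_integral => x _; rewrite muleCA (addrC _ m) -EFinM; congr (_ * _%:E)%E.
rewrite !normal_pdf1E ?oner_eq0// !normal_peakE /normal_fun.
rewrite normr1 invr1 mul1r !mulrA mulfV ?normr_eq0// mul1r.
by congr (_ * expR _); field; rewrite s0.
Qed.

(* Completing the square in [y]. *)
Lemma normal_pdf_mix a b x y : a != 0 ->
  let s := Num.sqrt (a ^+ 2 + b ^+ 2) in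
  normal_pdf (b * y) a x * normal_pdf 0 1 y =
  normal_pdf 0 s x * normal_pdf (b * x / s ^+ 2) (a / s) y.
Proof.
move=> a0 s.
have a2 : 0 < a ^+ 2 by rewrite lt0r sqrf_eq0 a0 sqr_ge0.
have s2 : s ^+ 2 = a ^+ 2 + b ^+ 2.
  by rewrite sqr_sqrtr// addr_ge0 ?sqr_ge0.
have s0 : 0 < s by rewrite sqrtr_gt0 ltr_wpDr// sqr_ge0.
have sn0 : s != 0 by rewrite gt_eqF.
have as0 : a / s != 0 by rewrite mulf_neq0 ?invr_eq0.
rewrite !normal_pdf1E ?oner_eq0// /normal_fun.
rewrite mulrACA [RHS]mulrACA -!expRD; congr (_ * expR _).
  rewrite !normal_peakE normr1 normf_div (gtr0_norm s0).
  by field; rewrite normr_eq0 a0 sn0 sqrtr_eq0 -ltNge pmulrn_lgt0// pi_gt0.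
have hs : a ^+ 2 + b ^+ 2 != 0 by rewrite -s2 expf_neq0.
by rewrite !expr_div_n s2; field; rewrite a0 hs.
Qed.

(** Stability of the normal law under independent sums. By Tonelli the joint density can be
    integrated in [y] first; [normal_pdf_mix] factors it as a marginal in [x] times a normal density
    in [y] of total mass 1. *)
Lemma ge0_integral_gauss_mix a b f : measurable_fun [set: R] f ->
  (forall x, 0 <= f x)%E ->
  (\int[gam]_y \int[gam]_x f (a * x + b * y)%R =
   \int[gam]_z f (Num.sqrt (a ^+ 2 + b ^+ 2) * z)%R)%E.
Proof.
move=> mf f0.
have mfM k : measurable_fun setT (fun x : R => f (k * x)).
  by apply: measurableT_comp => //; exact: measurable_funM.
(* For [a = 0] the inner law is a point mass without density; [b] then enters the right side only
   through [|b|]. *)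
have [->|a0] := eqVneq a 0.
  rewrite expr0n /= add0r sqrtr_sqr.
  under eq_integral => y _.
    under eq_integral do rewrite mul0r add0r.
    rewrite integral_cst//= probability_setT mule1.
    over.
  have [->|b0] := eqVneq b 0; first by rewrite normr0.
  transitivity (\int[normal_prob 0 b]_x f x)%E.
    rewrite -[RHS]ge0_integral_gauss_affine//.
    by apply: eq_integral => z _; rewrite add0r.
  rewrite -(_ : normal_prob 0 `|b| = normal_prob 0 b).
    rewrite -[LHS]ge0_integral_gauss_affine ?normr_eq0//.
    by apply: eq_integral => z _; rewrite add0r.
  apply/funext => A; rewrite /normal_prob; apply: eq_integral => x _.
  rewrite !normal_pdf1E ?normr_eq0// /normal_peak /normal_fun.
  by rewrite !real_normK// num_real.
set s := Num.sqrt _.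
have s0 : s != 0.
  by rewrite gt_eqF// sqrtr_gt0 ltr_wpDr ?sqr_ge0// lt0r sqrf_eq0 a0 sqr_ge0.
transitivity (\int[gam]_y \int[normal_prob (b * y) a]_x f x)%E.
  apply: eq_integral => y _; rewrite -[RHS]ge0_integral_gauss_affine//.
  by apply: eq_integral => x _; rewrite addrC.
transitivity (\int[normal_prob 0 s]_x f x)%E; last first.
  rewrite -[LHS]ge0_integral_gauss_affine//.
  by apply: eq_integral => z _; rewrite add0r.
pose h (p : R * R) := (f p.1 * (normal_pdf (b * p.2) a p.1 * normal_pdf 0 1 p.2)%:E)%E.
have mpdf : measurable_fun setT (fun p : R * R => normal_pdf (b * p.2) a p.1).
  rewrite (_ : (fun _ => _) = (fun p : R * R => normal_pdf 0 a (p.1 - b * p.2))).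
    apply: (measurableT_comp (measurable_normal_pdf 0 a)).
    apply: measurable_funB; first exact: measurable_fst.
    by apply: measurable_funM => //; exact: measurable_snd.
  apply/funext => -[x y] /=; rewrite !normal_pdf1E// /normal_fun.
  by rewrite subr0.
have mh : measurable_fun setT h.
  apply: emeasurable_funM.
    by apply: (measurableT_comp mf); exact: measurable_fst.
  apply/measurable_EFinP; apply: measurable_funM => //.
  apply: (measurableT_comp (measurable_normal_pdf 0 1)).
  exact: measurable_snd.
have h0 p : (0 <= h p)%E.
  by rewrite mule_ge0// lee_fin mulr_ge0// normal_pdf_ge0.
transitivity (\int[mu]_y \int[mu]_x h (x, y))%E.
  rewrite ge0_integral_normal//; last 2 first.
  - rewrite (_ : (fun _ => _) = (fun y => \int[mu]_x (f x * (normal_pdf (b * y) a x)%:E)))%E.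
      apply: (@measurable_fun_fubini_tonelli_G _ _ (measurableTypeR R) (measurableTypeR R) R mu
       (fun p => f p.1 * (normal_pdf (b * p.2) a p.1)%:E)%E).
        apply: emeasurable_funM; last exact/measurable_EFinP.
        by apply: (measurableT_comp mf); exact: measurable_fst.
      by move=> p; rewrite mule_ge0// lee_fin normal_pdf_ge0.
    by apply/funext => y; rewrite ge0_integral_normal.
  - by move=> y; exact: integral_ge0.
  apply: eq_integral => y _; rewrite ge0_integral_normal// -ge0_integralZr//; last 3 first.
  - apply: emeasurable_funM => //=; apply/measurable_EFinP.
    exact: measurable_normal_pdf.
  - by move=> x _; rewrite mule_ge0// lee_fin normal_pdf_ge0.
  - by rewrite lee_fin normal_pdf_ge0.
  by apply: eq_integral => x _; rewrite /h /= EFinM muleA.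
rewrite -(@fubini_tonelli _ _ (measurableTypeR R) (measurableTypeR R))//.
rewrite ge0_integral_normal//; apply: eq_integral => x _.
rewrite /h /=.
under eq_integral => y _ do rewrite normal_pdf_mix// EFinM muleA.
rewrite ge0_integralZl//.
- by rewrite integral_normal_pdf mule1.
- by apply/measurable_EFinP; exact: measurable_normal_pdf.
- by move=> y _; rewrite lee_fin normal_pdf_ge0.
- by rewrite mule_ge0// lee_fin normal_pdf_ge0.
Qed.

(* The integrand times the density is, up to the factor [s], the density of
   N(0, s^2); letting [s] tend to 1 yields the second moment below. *)
Lemma integral_gauss_expR s : 0 < s ->
  (\int[gam]_x (expR ((1 - s ^- 2) / 2 * x ^+ 2))%:E = s%:E)%E.
Proof.
move=> s0; have sn0 : s != 0 by rewrite gt_eqF.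
rewrite ge0_integral_normal; last 2 first.
- apply/measurable_EFinP; apply: measurableT_comp => //.
  by apply: measurable_funM => //; exact: measurable_funX.
- by move=> x; rewrite lee_fin expR_ge0.
transitivity (\int[mu]_x (s%:E * (normal_pdf 0 s x)%:E))%E.
  apply: eq_integral => x _; rewrite -!EFinM; congr EFin.
  rewrite !normal_pdf1E ?oner_eq0// !normal_peakE /normal_fun normr1 gtr0_norm//.
  rewrite mulrCA -expRD !mulrA divff// !mul1r invr1 mul1r; congr (_ * expR _).
  by field; rewrite sn0.
rewrite ge0_integralZl//.
- by rewrite integral_normal_pdf mule1.
- by apply/measurable_EFinP; exact: measurable_normal_pdf.
- by move=> y _; rewrite lee_fin normal_pdf_ge0.
- by rewrite lee_fin ltW.
Qed.

Lemma measurable_monomial k (n : nat) :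
  measurable_fun [set: R] (fun x : R => (k * x ^+ n)%:E).
Proof.
by apply/measurable_EFinP; apply: measurable_funM => //; exact: measurable_funX.
Qed.

Definition biquadratic c0 c2 c4 x : R := c0 + c2 * x ^+ 2 + c4 * x ^+ 4.

(** Domination by the exponential of [integral_gauss_expR] at s = 2, that is t = 3 x^2 / 8. Since
    exp t >= (1 + t/2)^2, whose x^4 coefficient is 9/256, the factor 64 covers both powers. *)
Lemma integrable_gauss_expn (n : nat) : (n = 2 \/ n = 4)%N ->
  (gam : {measure set _ -> \bar R}).-integrable setT
    (fun x : R => (x ^+ n)%:E).
Proof.
move=> n24.
have h : gam.-integrable setT (fun x : R =>
     (64%:R%:E * (expR ((1 - 2 ^- 2) / 2 * x ^+ 2))%:E)%E).
  apply: integrableZl => //; apply/integrableP; split.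
    apply/measurable_EFinP; apply: measurableT_comp => //.
    by apply: measurable_funM => //; exact: measurable_funX.
  under eq_integral do rewrite /= ger0_norm ?expR_ge0//.
  by rewrite integral_gauss_expR ?ltry// ltr0n.
apply: (le_integrable _ _ _ h) => //.
  by have := measurable_monomial 1 n; under eq_fun do rewrite mul1r.
move=> x _; rewrite -EFinM !abse_EFin lee_fin.
rewrite [leRHS]ger0_norm ?mulr_ge0 ?expR_ge0//.
set t := (1 - 2 ^- 2) / 2 * x ^+ 2.
have tE : t = 3 / 8 * x ^+ 2 by rewrite /t; field.
have x2 := sqr_ge0 x.
have t0 : 0 <= t / 2 by rewrite tE; lra.
have e1 := expR_ge1Dx (t / 2).
have : (1 + t / 2) ^+ 2 <= expR t.
  have -> : expR t = expR (t / 2) ^+ 2 by rewrite -expRM_natr divfK.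
  by rewrite ler_sqr ?nnegrE ?expR_ge0// addr_ge0.
have -> : (1 + t / 2) ^+ 2 = 1 + 3 / 8 * x ^+ 2 + 9 / 256 * x ^+ 4.
  by rewrite tE; field.
have x4 : 0 <= x ^+ 4 by rewrite exprn_even_ge0.
by move: (expR t) => z ez; case: n24 => ->; rewrite ger0_norm//; lra.
Qed.

Local Notation m2 := (fine (\int[gam]_x (x ^+ 2)%:E)).
Local Notation m4 := (fine (\int[gam]_x (x ^+ 4)%:E)).

Lemma integrable_gauss_biquadratic c0 c2 c4 :
  (gam : {measure set _ -> \bar R}).-integrable setT
    (fun x => (biquadratic c0 c2 c4 x)%:E).
Proof.
have i2 := integrable_gauss_expn (or_introl erefl : (2 = 2 \/ 2 = 4)%N).
have i4 := integrable_gauss_expn (or_intror erefl : (4 = 2 \/ 4 = 4)%N).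
rewrite /biquadratic; under eq_fun do rewrite !EFinD !EFinM.
apply: integrableD => //; last exact: integrableZl.
apply: integrableD => //; last exact: integrableZl.
exact: finite_measure_integrable_cst.
Qed.

Lemma integral_gauss_biquadratic c0 c2 c4 :
  (\int[gam]_x (biquadratic c0 c2 c4 x)%:E = (c0 + c2 * m2 + c4 * m4)%:E)%E.
Proof.
have i2 := integrable_gauss_expn (or_introl erefl : (2 = 2 \/ 2 = 4)%N).
have i4 := integrable_gauss_expn (or_intror erefl : (4 = 2 \/ 4 = 4)%N).
have ic : gam.-integrable setT (fun x : R => c0%:E).
  exact: finite_measure_integrable_cst.
rewrite /biquadratic; under eq_integral do rewrite !EFinD !EFinM.
rewrite integralD//; last 2 first.
- by apply: integrableD => //; exact: integrableZl.
- exact: integrableZl.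
rewrite integralD//; last exact: integrableZl.
rewrite integral_cst//= probability_setT mule1 !integralZl//.
by rewrite !EFinD !EFinM !fineK// integrable_fin_num.
Qed.

(** Each even quartic below the exponential gives a linear inequality between the second and fourth
    moments; this replaces integration by parts. *)
Lemma gauss_biquadratic_le c0 c2 c4 s : 0 < s ->
  (forall x, biquadratic c0 c2 c4 x <= expR ((1 - s ^- 2) / 2 * x ^+ 2)) ->
  c0 + c2 * m2 + c4 * m4 <= s.
Proof.
move=> s0 h.
rewrite -lee_fin -integral_gauss_biquadratic -integral_gauss_expR//.
apply: le_integral => //.
- exact: integrable_gauss_biquadratic.
- apply/integrableP; split.
    apply/measurable_EFinP; apply: measurableT_comp => //.
    by apply: measurable_funM => //; exact: measurable_funX.
  under eq_integral do rewrite /= ger0_norm ?expR_ge0//.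
  by rewrite integral_gauss_expR// ltry.
- by move=> x _; rewrite lee_fin.
Qed.

(** From exp t >= 1 + t comes (s^2 - 1) m2 <= 2 s^2 (s - 1) for s on either side of 1. Dividing by s
    - 1 and letting s tend to 1 gives both inequalities. *)
Lemma gauss_moment2 : m2 = 1.
Proof.
have key s : 0 < s -> (s ^+ 2 - 1) * m2 <= 2 * s ^+ 2 * (s - 1).
  move=> s0; have := @gauss_biquadratic_le 1 ((1 - s ^- 2) / 2) 0 s s0.
  rewrite mul0r addr0 => H.
  have {H} : 1 + (1 - s ^- 2) / 2 * m2 <= s.
    by apply: H => x; rewrite /biquadratic mul0r addr0 expR_ge1Dx.
  move=> H; have s2 : 0 < 2 * s ^+ 2 by rewrite mulr_gt0// exprn_gt0.
  have := ler_wpM2l (ltW s2) H.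
  rewrite (_ : 2 * s ^+ 2 * (1 + (1 - s ^- 2) / 2 * m2) =
    2 * s ^+ 2 + (s ^+ 2 - 1) * m2); first by move=> ?; lra.
  by field; rewrite gt_eqF.
have m20 : 0 <= m2 by rewrite fine_ge0// integral_ge0// => x _; rewrite lee_fin sqr_ge0.
move: m20 key; set m := m2 => m20 key.
apply/eqP; rewrite eq_le; apply/andP; split; rewrite leNgt; apply/negP => h.
  (* A fixed s replaces the limit: s = 1 + e, with e a third of the excess over 1, already violates
     [key]. The lower bound uses s = 1 - e in the same way. *)
  have [e [e0 mE]] : exists e, 0 < e /\ m = 1 + 3 * e.
    by exists ((m - 1) / 3); split; lra.
  have := key (1 + e) (addr_gt0 ltr01 e0); rewrite mE.
  rewrite -subr_ge0 (_ : _ - _ = - (e ^+ 2 * (3 + e))); last by ring.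
  by rewrite oppr_ge0 leNgt mulr_gt0 ?exprn_gt0// addr_gt0.
have [e [e0 [e1 mE]]] : exists e, 0 < e /\ e < 1 /\ m = 1 - 3 * e.
  by exists ((1 - m) / 3); split; [|split]; lra.
have se : 0 < 1 - e by rewrite subr_gt0.
have := key (1 - e) se; rewrite mE.
rewrite -subr_ge0 (_ : _ - _ = - (e ^+ 2 * (3 - e))); last by ring.
by rewrite oppr_ge0 leNgt mulr_gt0 ?exprn_gt0// subr_gt0; lra.
Qed.

(* The value is 3; the bound from exp t >= (1 + t/4)^4 at [s = 11/10] is enough. *)
Lemma gauss_moment4 : m4 <= 5.
Proof.
have := @gauss_biquadratic_le 1 (21 / 242) (3 / 8 * (21 / 242) ^+ 2) (11 / 10).
rewrite gauss_moment2 => H.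
have {H} : 1 + 21 / 242 * 1 + 3 / 8 * (21 / 242) ^+ 2 * m4 <= 11 / 10.
  apply: H => [|x]; first by lra.
  have -> : (1 - (11 / 10) ^- 2) / 2 = 21 / 242 :> R by field.
  have t0 : 0 <= 21 / 242 * x ^+ 2 by have := sqr_ge0 x; lra.
  have -> : biquadratic 1 (21 / 242) (3 / 8 * (21 / 242) ^+ 2) x =
      1 + 21 / 242 * x ^+ 2 + 3 / 8 * (21 / 242 * x ^+ 2) ^+ 2.
    by rewrite /biquadratic; field.
  move: (21 / 242 * x ^+ 2) t0 => t t0.
  have -> : expR t = expR (t / 4) ^+ 4 by rewrite -expRM_natr divfK.
  have t3 : 0 <= t ^+ 3 by exact: exprn_ge0.
  have t4 : 0 <= t ^+ 4 by exact: exprn_ge0.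
  apply: (@le_trans _ _ ((1 + t / 4) ^+ 4)).
    by move: t3 t4 => /=; lra.
  by rewrite lerXn2r ?nnegrE ?expR_ge0 ?expR_ge1Dx// addr_ge0// mulr_ge0.
lra.
Qed.

Lemma integral_gaussN f : measurable_fun [set: R] f -> (forall x, 0 <= f x)%E ->
  (\int[gam]_x f (- x)%R = \int[gam]_x f x)%E.
Proof.
move=> mf f0; have N0 : -1 != 0 :> R by rewrite oppr_eq0 oner_eq0.
transitivity (\int[normal_prob 0 (-1)]_x f x)%E.
  rewrite -[RHS]ge0_integral_gauss_affine//.
  by apply: eq_integral => z _; rewrite add0r mulN1r.
apply: eq_measure_integral => A _ _; rewrite /= /normal_prob.
apply: eq_integral => x _.
by rewrite !normal_pdf1E ?oner_eq0// !normal_peakE /normal_fun sqrrN normrN.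
Qed.

(** Averaging over y and -y removes the odd terms, leaving q^2 + 4 l^2 + b^2 (m4 - 1);
    [gauss_moment4] bounds the last factor by 4. With y^2 - 1 centered, [q] and [b] do not
    interact. *)
Lemma integral_gauss_quadratic (q l b : R) :
  (\int[gam]_y ((q + 2 * l * y + b * (y ^+ 2 - 1)) ^+ 2)%:E <=
   (q ^+ 2 + 4 * l ^+ 2 + 4 * b ^+ 2)%:E)%E.
Proof.
set g := fun y => q + 2 * l * y + b * (y ^+ 2 - 1).
have mg : measurable_fun [set: R] (fun y => (g y ^+ 2)%:E).
  apply/measurable_EFinP; apply: measurable_funX.
  apply: measurable_funD; first by apply: measurable_funD => //; exact: measurable_funM.
  by apply: measurable_funM => //; apply: measurable_funB => //; exact: measurable_funX.
have g0 x : (0 <= (g x ^+ 2)%:E)%E by rewrite lee_fin sqr_ge0.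
have eN := integral_gaussN mg g0.
have : (\int[gam]_y (g y ^+ 2)%:E + \int[gam]_y (g (- y) ^+ 2)%:E =
   (2 * (q - b) ^+ 2 + (4 * (q - b) * b + 8 * l ^+ 2) * m2 + 2 * b ^+ 2 * m4)%:E)%E.
  rewrite -integral_gauss_biquadratic -ge0_integralD//.
    by apply: eq_integral => y _; rewrite -EFinD; congr EFin; rewrite /g /biquadratic; ring.
  by apply: (measurableT_comp mg).
rewrite eN gauss_moment2.
have := @integral_ge0 _ _ _ gam setT _ (fun x _ => g0 x).
case: (integral _ _ _) => //= r r0; rewrite -EFinD => -[e].
by rewrite lee_fin; have := gauss_moment4; have := sqr_ge0 b; nra.
Qed.

Lemma integral_gauss_norm : (\int[gam]_y `|y|%:E <= 1%:E)%E.
Proof.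
apply: (@le_trans _ _ (\int[gam]_x (biquadratic (1 / 2) (1 / 2) 0 x)%:E)%E).
  apply: ge0_le_integral => //.
  - by apply/measurable_EFinP; exact: normr_measurable.
  - by case/integrableP: (integrable_gauss_biquadratic (1/2) (1/2) 0).
  - move=> x _; rewrite lee_fin /biquadratic mul0r addr0.
    by rewrite -[x ^+ 2]real_normK ?num_real//; have := sqr_ge0 (`|x| - 1); lra.
by rewrite integral_gauss_biquadratic gauss_moment2 lee_fin; lra.
Qed.

End gaussian.

(** * Independence of the past of a sequence *)

Section past.
Context (R : realType) (d : measure_display) (T : measurableType d).
Context (P : probability T R) (zeta : nat -> {RV P >-> R}).
Local Notation gam := (@normal_prob R 0 1).
Local Notation RR := (measurableTypeR R).
Implicit Types (k n : nat) (B : nat -> set R).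

(* The pi-system generating the sigma-algebra of the first [k] variables. *)
Definition past k : set (set T) :=
  [set \bigcap_(i < k) (zeta i @^-1` B i) | B in
    [set B | forall i, measurable (B i)]].

Local Notation pastT k := (g_sigma_algebraType (past k)).

Lemma past_setI k : setI_closed (past k).
Proof.
move=> _ _ [B mB <-] [C mC <-]; exists (fun i => B i `&` C i).
  by move=> i; exact: measurableI.
rewrite -bigcapI; apply: eq_bigcapr => i _; exact: preimage_setI.
Qed.

Lemma past_setT k : past k setT.
Proof.
exists (fun=> setT) => //.
by apply/seteqP; split => // w _ i _.
Qed.

Lemma past_measurable k (A : set T) : past k A -> measurable A.
Proof.
move=> [B mB <-]; rewrite bigcap_mkord; apply: bigsetI_measurable => i _.
by rewrite -[X in measurable X]setTI; exact: measurable_funP.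
Qed.

Lemma sub_past_measurable k (A : set T) : <<s past k >> A -> measurable A.
Proof.
apply: (smallest_sub (@sigma_algebra_measurable _ T)).
exact: past_measurable.
Qed.

(** The identity into the coarser measurable space: its law is [P] restricted to the past, and
    composing with it turns dependence on the past into ordinary measurability on [T]. *)
Definition past_id k : T -> pastT k := id.

Lemma measurable_past_id k : measurable_fun setT (past_id k).
Proof. by move=> _ A mA; rewrite setTI; exact: (sub_past_measurable mA). Qed.

HB.instance Definition _ k :=
  isMeasurableFun.Build _ _ _ _ (past_id k) (@measurable_past_id k).

Lemma past_incl n k : (n <= k)%N ->
  measurable_fun setT (id : pastT k -> pastT n).
Proof.
move=> nk; apply: (@measurability _ _ (pastT k) (pastT n) setT id (past n)) =>
  // _ [_ [B mB <-] <-]; rewrite setTI.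
apply: sub_sigma_algebra.
exists (fun i => if (i < n)%N then B i else setT).
  by move=> i; case: ifP.
apply/seteqP; split => w /= h i /= ik.
  by have := h i (leq_trans ik nk); rewrite ik.
by case: ifPn => // iln; exact: h.
Qed.

Lemma measurable_past i k : (i < k)%N ->
  measurable_fun setT (zeta i : pastT k -> R).
Proof.
move=> ik _ A mA; rewrite setTI; apply: sub_sigma_algebra.
exists (fun j => if j == i then A else setT) => /=; first by move=> j; case: ifP.
apply/seteqP; split => w /= h.
  by have := h i ik; rewrite eqxx.
by move=> j jk /=; case: eqVneq => [->|].
Qed.

Hypothesis zeta_indep : forall k B, (forall i, measurable (B i)) ->
  P (\bigcap_(i < k) (zeta i @^-1` B i)) =
  (\prod_(i < k) P (zeta i @^-1` B i))%E.
Hypothesis zeta_normal : forall i, normal_rv 0 1 (zeta i).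

(** For fixed [C] both sides are finite measures in [E], so it suffices to compare them on the
    pi-system [past k]. There [C] is appended as the set for index [k], and independence is used at
    lengths [k.+1] and [k]. *)
Lemma past_indep k (E : set T) (C : set R) : <<s past k >> E -> measurable C ->
  P (E `&` zeta k @^-1` C) = (P E * gam C)%E.
Proof.
move=> mE mC; have mzC : measurable (zeta k @^-1` C).
  by rewrite -[X in measurable X]setTI; exact: measurable_funP.
have fC : P (zeta k @^-1` C) \is a fin_num by exact: fin_num_measure.
pose m2 := mscale (NngNum (fine_ge0 (measure_ge0 P (zeta k @^-1` C)))) P.
have -> : P (E `&` zeta k @^-1` C) = mrestr P mzC E by [].
have m2E A : m2 A = (P (zeta k @^-1` C) * P A)%E by rewrite /m2 /mscale /= fineK.
have -> : (P E * gam C = m2 E)%E.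
  by rewrite -(zeta_normal k mC) m2E muleC.
suff : (mrestr P mzC : {measure set T -> \bar R}) E =
       (m2 : {measure set T -> \bar R}) E by [].
apply: (g_sigma_algebra_measure_unique (past k) _ (fun _ => setT)) => //.
- exact: past_measurable.
- by move=> _; exact: past_setT.
- by rewrite bigcup_const.
- exact: past_setI.
- move=> _ [B mB <-]; rewrite [RHS]m2E /mrestr /=.
  pose B' i := if (i < k)%N then B i else C.
  have mB' i : measurable (B' i) by rewrite /B'; case: ifP.
  transitivity (P (\bigcap_(i < k.+1) (zeta i @^-1` B' i))).
    congr (P _); rewrite !bigcap_mkord big_ord_recr /= /B' ltnn; congr (_ `&` _).
    by apply: eq_bigr => i _; rewrite ltn_ord.
  rewrite !zeta_indep// big_ord_recr /= {2}/B' ltnn muleC; congr (_ * _)%E.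
  by apply: eq_bigr => i _; rewrite /B' ltn_ord.
- by move=> _; rewrite /= /mrestr setTI -ge0_fin_numE ?fin_num_measure.
Qed.

Definition past_pair k (w : T) : pastT k * RR := (past_id k w, zeta k w).

Lemma measurable_past_pair k : measurable_fun setT (past_pair k).
Proof.
apply: (@measurable_fun_pair _ _ _ T (pastT k) RR).
  exact: measurable_past_id.
exact: (measurable_funP (zeta k)).
Qed.

HB.instance Definition _ k :=
  isMeasurableFun.Build _ _ _ _ (past_pair k) (@measurable_past_pair k).

(** The freezing lemma: by [past_indep] the joint law of the past and the next variable agrees with
    a product measure on rectangles, hence is that product, and Tonelli applies. *)
Lemma past_fubini k (h : pastT k * RR -> \bar R) :
  measurable_fun setT h -> (forall p, 0 <= h p)%E ->
  (\int[P]_w h (w, zeta k w) = \int[P]_w \int[gam]_y h (w, y))%E.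
Proof.
move=> mh h0.
transitivity (\int[pushforward P (past_pair k)]_p h p)%E.
  by rewrite [RHS](ge0_integral_pushforward (@measurable_past_pair k) P
    measurableT mh (fun p _ => h0 p)).
transitivity (\int[(distribution P (past_id k) \x gam)%E]_p h p)%E.
  apply: eq_measure_integral => A mA _; apply/esym.
  apply: product_measure_unique => // E C mE mC.
  exact: past_indep.
rewrite fubini_tonelli1; [|exact: mh|exact: h0].
rewrite [LHS](ge0_integral_pushforward (@measurable_past_id k) P measurableT)//.
- exact: measurable_fun_fubini_tonelli_F.
- by move=> w _; exact: integral_ge0.
Qed.

Lemma measurable_past_lin (c : nat -> R) k :
  measurable_fun setT (fun w : pastT k => \sum_(j < k) c j * zeta j w).
Proof.
by apply: measurable_sum => j; apply: measurable_funM => //; exact: measurable_past.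
Qed.

Lemma measurable_past_quad (B : nat -> nat -> R) k :
  measurable_fun setT (fun w : pastT k =>
    \sum_(i < k) \sum_(j < k) B i j * zeta i w * zeta j w).
Proof.
apply: measurable_sum => i; apply: measurable_sum => j.
by do 2?[apply: measurable_funM => //]; exact: measurable_past.
Qed.

Lemma measurable_sqr_fin d' (U : measurableType d') (f : U -> R) :
  measurable_fun setT f -> measurable_fun setT (fun u => (f u ^+ 2)%:E).
Proof. by move=> mf; apply/measurable_EFinP; exact: measurable_funX. Qed.

(** Once the past is frozen, [q w] and [l w] are constants and [integral_gauss_quadratic] applies
    for each [w]. This is the inductive step of both moment bounds below. *)
Lemma past_step k (q l : T -> R) (b : R) :
  measurable_fun setT (q : pastT k -> R) -> measurable_fun setT (l : pastT k -> R) ->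
  (\int[P]_w ((q w + 2 * l w * zeta k w + b * (zeta k w ^+ 2 - 1)) ^+ 2)%:E <=
   \int[P]_w (q w ^+ 2)%:E + (4 : R)%:E * \int[P]_w (l w ^+ 2)%:E + (4 * b ^+ 2)%:E)%E.
Proof.
move=> mq ml.
pose h (p : pastT k * RR) :=
  ((q p.1 + 2 * l p.1 * p.2 + b * (p.2 ^+ 2 - 1)) ^+ 2)%:E.
have mq' : measurable_fun setT q by exact: (measurableT_comp mq (@measurable_past_id k)).
have ml' : measurable_fun setT l by exact: (measurableT_comp ml (@measurable_past_id k)).
have mq1 : measurable_fun setT (fun p : pastT k * RR => q p.1).
  by apply: (measurableT_comp mq); exact: measurable_fst.
have ml1 : measurable_fun setT (fun p : pastT k * RR => l p.1).
  by apply: (measurableT_comp ml); exact: measurable_fst.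
have m2 : measurable_fun setT (fun p : pastT k * RR => p.2 : R).
  exact: measurable_snd.
have mh : measurable_fun setT h.
  apply: measurable_sqr_fin; apply: measurable_funD.
    by apply: measurable_funD => //; apply: measurable_funM => //; exact: measurable_funM.
  apply: measurable_funM => //; apply: measurable_funB => //; exact: measurable_funX.
have h0 p : (0 <= h p)%E by rewrite lee_fin sqr_ge0.
rewrite [leLHS](past_fubini mh h0).
have mq2 := measurable_sqr_fin mq'; have ml2 := measurable_sqr_fin ml'.
rewrite -ge0_integralZl//; last by move=> w _; rewrite lee_fin sqr_ge0.
rewrite -[X in (_ + X)%E](_ : (\int[P]_w (cst (4 * b ^+ 2)%:E w) = (4 * b ^+ 2)%:E)%E); last first.
  by rewrite integral_cst//= probability_setT mule1.
rewrite -ge0_integralD//; last 3 first.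
- by move=> w _; rewrite lee_fin sqr_ge0.
- by move=> w _; rewrite -EFinM lee_fin mulr_ge0// sqr_ge0.
- exact: measurable_funeM.
rewrite -ge0_integralD//; last 3 first.
- by move=> w _; rewrite -EFinM -EFinD lee_fin addr_ge0 ?sqr_ge0 // mulr_ge0 // sqr_ge0.
- by apply: emeasurable_funD => //; exact: measurable_funeM.
- by move=> w _; rewrite lee_fin mulr_ge0 // sqr_ge0.
apply: ge0_le_integral => //.
- by move=> w _; exact: integral_ge0.
- have := @measurable_fun_fubini_tonelli_F _ _ _ _ R gam h mh h0.
  by move=> /measurableT_comp; apply; exact: measurable_past_id.
- apply: emeasurable_funD => //; apply: emeasurable_funD => //; exact: measurable_funeM.
- move=> w _; rewrite /cst -EFinM -!EFinD; exact: (integral_gauss_quadratic (q w) (l w) b).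
Qed.

Lemma past_lin_moment (c : nat -> R) k :
  (\int[P]_w ((\sum_(j < k) c j * zeta j w) ^+ 2)%:E <=
   (\sum_(j < k) c j ^+ 2)%:E)%E.
Proof.
elim: k => [|k IH].
  by under eq_integral do rewrite big_ord0 expr0n /=; rewrite integral0 big_ord0.
(* The constant [l = c k / 2] makes the linear term [c k * zeta k] and its contribution [4 * l ^+ 2]
   equal to [c k ^+ 2]. *)
have mc : measurable_fun setT ((fun=> c k / 2) : pastT k -> R).
  exact: measurable_cst.
have := past_step 0 (@measurable_past_lin c k) mc.
under [leLHS]eq_integral => w _.
  rewrite mul0r addr0 (_ : 2 * (c k / 2) = c k); last by field.
  over.
move=> H.
under [leLHS]eq_integral do rewrite big_ord_recr /=.
rewrite big_ord_recr /=.
apply: (le_trans H).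
rewrite integral_cst//= probability_setT mule1 expr0n /= mulr0 adde0.
rewrite -EFinM (_ : 4 * _ = c k ^+ 2); last by field.
by rewrite EFinD; exact: leeD2r.
Qed.

(** Adding variable [k] to the centered form adds 2 l zeta_k + B_kk (zeta_k^2 - 1), where [l] is the
    linear form of row [k]; symmetry merges row and column. This is the shape of [past_step], and
    [past_lin_moment] bounds the second moment of [l]. *)
Lemma past_quad_moment (B : nat -> nat -> R) k : (forall i j, B i j = B j i) ->
  (\int[P]_w ((\sum_(i < k) \sum_(j < k) B i j * zeta i w * zeta j w -
    \sum_(i < k) B i i) ^+ 2)%:E <=
   (4 * \sum_(i < k) \sum_(j < k) B i j ^+ 2)%:E)%E.
Proof.
move=> Bsym; elim: k => [|k IH].
  under eq_integral do rewrite !big_ord0 subrr expr0n /=.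
  by rewrite integral0 big_ord0 mulr0.
pose q w := \sum_(i < k) \sum_(j < k) B i j * zeta i w * zeta j w - \sum_(i < k) B i i.
pose l w := \sum_(j < k) B k j * zeta j w.
have mq : measurable_fun setT (q : pastT k -> R).
  by apply: measurable_funB => //; exact: measurable_past_quad.
have := past_step (B k k) mq (@measurable_past_lin (B k) k).
rewrite -/(l _) => H.
have E w : \sum_(i < k.+1) \sum_(j < k.+1) B i j * zeta i w * zeta j w -
    \sum_(i < k.+1) B i i =
    q w + 2 * l w * zeta k w + B k k * (zeta k w ^+ 2 - 1).
  have E1 : \sum_(i < k) B i k * zeta i w * zeta k w = l w * zeta k w.
    by rewrite mulr_suml; apply: eq_bigr => i _; rewrite Bsym.
  have E2 : \sum_(j < k) B k j * zeta k w * zeta j w = l w * zeta k w.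
    by rewrite mulr_suml; apply: eq_bigr => i _; rewrite mulrAC.
  rewrite !big_ord_recr /= E2.
  under eq_bigr do rewrite big_ord_recr /=.
  by rewrite big_split /= E1 /q; ring.
under [leLHS]eq_integral do rewrite E.
apply: (le_trans H).
have L := past_lin_moment (B k) k.
apply: (@le_trans _ _ ((4 * \sum_(i < k) \sum_(j < k) B i j ^+ 2)%:E +
   (4 : R)%:E * (\sum_(j < k) B k j ^+ 2)%:E + (4 * B k k ^+ 2)%:E)%E).
  by rewrite leeD2r// leeD// lee_wpmul2l// lee_fin.
rewrite -EFinM -!EFinD lee_fin !big_ord_recr /=.
under [in leRHS]eq_bigr do rewrite big_ord_recr /=.
have E1 : \sum_(i < k) B i k ^+ 2 = \sum_(i < k) B k i ^+ 2.
  by apply: eq_bigr => i _; rewrite Bsym.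
rewrite big_split /= E1.
have : 0 <= \sum_(i < k) B k i ^+ 2 by apply: sumr_ge0 => i _; exact: sqr_ge0.
by set S := \sum_(i < k) B k i ^+ 2; set D := \sum_(i < k) _; lra.
Qed.

(** The coefficients depend only on the first [n] variables, so they are frozen while the later
    variables are integrated out one at a time, each normal summand merging with the others by
    [ge0_integral_gauss_mix]. The induction changes [h], which is why [h] is general and sees the
    past. *)
Lemma past_gauss_mix n (a : nat -> T -> R) :
  (forall j, measurable_fun setT (a j : pastT n -> R)) ->
  forall k (h : pastT n * RR -> \bar R),
  measurable_fun setT h -> (forall p, 0 <= h p)%E ->
  (\int[P]_w h (w, (\sum_(j < k) a j w * zeta (n + j)%N w)%R) =
   \int[P]_w \int[gam]_z h (w, (Num.sqrt (\sum_(j < k) a j w ^+ 2) * z)%R))%E.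
Proof.
move=> ma; elim=> [|k IH] h mh h0.
  apply: eq_integral => w _; rewrite !big_ord0.
  under eq_integral do rewrite sqrtr0 mul0r.
  by rewrite integral_cst//= probability_setT mule1.
pose W w := \sum_(j < k) a j w * zeta (n + j)%N w.
have ma' m j : (n <= m)%N -> measurable_fun setT (a j : pastT m -> R).
  by move=> nm; exact: (measurableT_comp (ma j) (past_incl nm)).
have mW : measurable_fun setT (W : pastT (n + k) -> R).
  apply: measurable_sum => j; apply: measurable_funM.
    by apply: ma'; rewrite leq_addr.
  by apply: measurable_past; rewrite ltn_add2l.
(* The partial sum [W] belongs to the past of variable [n + k], which can therefore be integrated
   out first. *)
pose h1 (p : pastT (n + k) * RR) := h (p.1, W p.1 + a k p.1 * p.2).
have mh1 : measurable_fun setT h1.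
  apply: (measurableT_comp mh); apply: measurable_fun_pair.
    by apply: (measurableT_comp (past_incl (leq_addr k n))); exact: measurable_fst.
  apply: measurable_funD; first by apply: (measurableT_comp mW); exact: measurable_fst.
  apply: measurable_funM; last exact: measurable_snd.
  by apply: (measurableT_comp (ma' _ _ (leq_addr k n))); exact: measurable_fst.
transitivity (\int[P]_w h1 (w, zeta (n + k)%N w))%E.
  by apply: eq_integral => w _; rewrite big_ord_recr.
rewrite (past_fubini mh1) => [|p]; last exact: h0.
(* With the last summand integrated out, what remains is again a function of the past at [n] and of
   the sum of [k] terms: the induction hypothesis applies to it. *)
pose h2 (p : pastT n * RR) := (\int[gam]_y h (p.1, (p.2 + a k p.1 * y)%R))%E.
have mh2 : measurable_fun setT h2.
  pose f (u : (pastT n * RR) * RR) := h (u.1.1, u.1.2 + a k u.1.1 * u.2).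
  apply: (@measurable_fun_fubini_tonelli_F _ _ _ _ R gam f) => [|u]; last exact: h0.
  apply: (measurableT_comp mh); apply: measurable_fun_pair.
    by apply: (measurableT_comp measurable_fst); exact: measurable_fst.
  apply: measurable_funD.
    by apply: (measurableT_comp measurable_snd); exact: measurable_fst.
  apply: measurable_funM; last exact: measurable_snd.
  apply: (measurableT_comp (ma k)).
  by apply: (measurableT_comp measurable_fst); exact: measurable_fst.
transitivity (\int[P]_w h2 (w, W w))%E; first by [].
rewrite (IH h2 mh2) => [|p]; last by apply: integral_ge0 => y _; exact: h0.
apply: eq_integral => w _.
pose s := Num.sqrt (\sum_(j < k) a j w ^+ 2).
have mhw : measurable_fun setT (fun u : R => h (w, u)).
  apply: (measurableT_comp mh); exact: measurable_fun_pair.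
transitivity (\int[gam]_z \int[gam]_y h (w, (a k w * y + s * z)%R))%E.
  by apply: eq_integral => z _; apply: eq_integral => y _; rewrite addrC.
rewrite (@ge0_integral_gauss_mix R (a k w) s (fun u => h (w, u)))//.
rewrite sqr_sqrtr; last by apply: sumr_ge0 => j _; exact: sqr_ge0.
by rewrite big_ord_recr /= addrC.
Qed.

End past.

(** * The covariance matrix of an AR(1) path *)

Section sums.
Context (R : realFieldType).
Implicit Types (n : nat) (p x u : nat -> R) (M : nat -> nat -> R).

(** Cauchy-Schwarz with weights of total mass at most [r]: expand the nonnegative sum of p_k (r x_k
    - S)^2, S being the weighted sum. *)
Lemma weighted_sqr_sum n p x r : 0 < r -> (forall k, 0 <= p k) ->
  \sum_(k < n) p k <= r ->
  (\sum_(k < n) p k * x k) ^+ 2 <= r * \sum_(k < n) p k * x k ^+ 2.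
Proof.
move=> r0 p0 pr; move SE : (\sum_(k < n) p k * x k) => S.
set Q := \sum_(k < n) p k * x k ^+ 2.
have : 0 <= \sum_(k < n) p k * (r * x k - S) ^+ 2.
  by apply: sumr_ge0 => k _; rewrite mulr_ge0// sqr_ge0.
have -> : \sum_(k < n) p k * (r * x k - S) ^+ 2 =
    r ^+ 2 * Q - 2 * r * S * (\sum_(k < n) p k * x k) + S ^+ 2 * \sum_(k < n) p k.
  rewrite /Q !mulr_sumr -sumrB -big_split /=.
  by apply: eq_bigr => k _; ring.
rewrite SE; have := ler_wpM2l (sqr_ge0 S) pr.
move: (\sum_(k < n) p k) => p1 h1 h2.
have : 0 <= r * (r * Q - S ^+ 2) by move: h1 h2; nra.
by rewrite pmulr_rge0// subr_ge0.
Qed.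

Lemma sqr_sum_le n x : (\sum_(k < n) x k) ^+ 2 <= n%:R * \sum_(k < n) x k ^+ 2.
Proof.
case: n => [|n]; first by rewrite !big_ord0 expr0n mulr0.
have := @weighted_sqr_sum n.+1 (fun=> 1) x n.+1%:R.
under [X in _ -> _ -> _ -> X ^+ 2 <= _]eq_bigr do rewrite mul1r.
under [X in _ -> _ -> _ -> _ <= _ * X]eq_bigr do rewrite mul1r.
by apply; rewrite ?ltr0n// sumr_const card_ord.
Qed.

(** Each row is handled by Cauchy-Schwarz with weights [|M i k|], at the cost of one row sum;
    exchanging the sums then costs one column sum. *)
Lemma schur_test n M u r : 0 < r ->
  (forall i, (i < n)%N -> \sum_(k < n) `|M i k| <= r) ->
  (forall k, (k < n)%N -> \sum_(i < n) `|M i k| <= r) ->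
  \sum_(i < n) (\sum_(k < n) M i k * u k) ^+ 2 <= r ^+ 2 * \sum_(k < n) u k ^+ 2.
Proof.
move=> r0 Hr Hc.
apply: (@le_trans _ _ (\sum_(i < n) r * \sum_(k < n) `|M i k| * u k ^+ 2)).
  apply: ler_sum => i _.
  have := @weighted_sqr_sum n (fun k => `|M i k|) (fun k => `|u k|) r r0
    (fun k => normr_ge0 _) (Hr i (ltn_ord i)).
  under [X in _ <= _ * X -> _]eq_bigr do rewrite real_normK ?num_real//.
  apply: le_trans; rewrite -[leLHS]real_normK ?num_real//.
  rewrite ler_sqr ?nnegrE ?sumr_ge0//.
  apply: (le_trans (ler_norm_sum _ _ _)).
  by apply: ler_sum => k _; rewrite normrM.
rewrite -mulr_sumr exchange_big /= expr2 -mulrA ler_pM2l//.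
rewrite mulr_sumr; apply: ler_sum => k _; rewrite -mulr_suml.
by rewrite ler_wpM2r ?sqr_ge0// Hc.
Qed.

End sums.

Section geometric.
Context (R : realFieldType).

Lemma sum_geo (x : R) n : (1 - x) * \sum_(i < n) x ^+ i = 1 - x ^+ n.
Proof.
elim: n => [|n IH]; first by rewrite big_ord0 expr0 subrr mulr0.
by rewrite big_ord_recr /= mulrDr IH exprS; ring.
Qed.

Lemma sum_geo_le (x : R) n : 0 <= x < 1 -> \sum_(i < n) x ^+ i <= (1 - x)^-1.
Proof.
move=> /andP[x0 x1].
have h : 0 < 1 - x by rewrite subr_gt0.
rewrite -(ler_pM2l h) sum_geo divff ?gt_eqF//.
by rewrite gerBl exprn_ge0.
Qed.

End geometric.

(** * The matrix of the path and its operator norm *)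

Section ar1_matrix.
Context (R : realFieldType) (al : R).
Hypothesis al1 : `|al| < 1.
Implicit Types (n i j k l : nat) (u x y : nat -> R).
Local Notation r := (1 - `|al|)^-1.

(** The lower triangular matrix L from innovations to path. Indices start at 0, so row [i] is time
    [i.+1]. Below, [ar1_gram] is L^T L and [ar1_colsum] is L^T applied to the constant vector 1. *)
Definition ar1_mx i k : R := if (k <= i)%N then al ^+ (i - k) else 0.

Definition ar1_gram n k l : R := \sum_(i < n) ar1_mx i k * ar1_mx i l.

Definition ar1_colsum n k : R := \sum_(i < n) ar1_mx i k.

(* The matrix [L^T P L] of the empirical covariance as a bilinear form in the
   innovations, [P] being the projection orthogonal to the constants. *)
Definition cov_mx n k l : R :=
  ar1_gram n k l - ar1_colsum n k * ar1_colsum n l / n%:R.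

Lemma cov_mxC n k l : cov_mx n k l = cov_mx n l k.
Proof.
rewrite /cov_mx (mulrC (ar1_colsum n k)); congr (_ - _).
by apply: eq_bigr => i _; rewrite mulrC.
Qed.

Let a0 : 0 <= `|al| < 1. Proof. by rewrite normr_ge0 al1. Qed.
Let r0 : 0 < r. Proof. by rewrite invr_gt0 subr_gt0. Qed.

Lemma ar1_mx_row_sum n i : \sum_(k < n) `|ar1_mx i k| <= r.
Proof.
apply: le_trans (sum_geo_le i.+1 a0).
rewrite -(big_mkord xpredT (fun k => `|ar1_mx i k|)).
rewrite (reindex_inj rev_ord_inj) /= -(big_mkord xpredT (fun k => `|al| ^+ (i.+1 - k.+1))).
apply: (@le_trans _ _ (\sum_(0 <= k < i.+1) `|ar1_mx i k|)); last first.
  rewrite !big_mkord; apply: ler_sum => k _.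
  by rewrite /ar1_mx -ltnS ltn_ord normrX subSS.
case: (leqP n i.+1) => h.
  rewrite [leRHS](big_cat_nat (n := n))//= lerDl.
  by apply: sumr_ge0.
rewrite [leLHS](big_cat_nat (n := i.+1))//= ?(ltnW h)// gerDl big_nat big1// => k /andP[ik _].
by rewrite /ar1_mx leqNgt ik normr0.
Qed.

Lemma ar1_mx_col_sum n k : \sum_(i < n) `|ar1_mx i k| <= r.
Proof.
apply: le_trans (sum_geo_le n a0).
rewrite -(big_mkord xpredT (fun i => `|ar1_mx i k|)).
rewrite -(big_mkord xpredT (fun i => `|al| ^+ i)).
case: (leqP n k) => h.
  rewrite big_nat big1; first by apply: sumr_ge0 => i _; rewrite exprn_ge0.
  by move=> i /andP[_ ik]; rewrite /ar1_mx leqNgt (leq_trans ik h) normr0.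
rewrite (big_cat_nat (n := k))//= ?(ltnW h)// big_nat big1 => [|i /andP[_ ik]]; last first.
  by rewrite /ar1_mx leqNgt ik normr0.
rewrite add0r -{1}[k]add0n big_addn.
rewrite [leRHS](big_cat_nat (n := (n - k)%N)) ?leq_subr//=.
rewrite -[leLHS]addr0 lerD//; last by apply: sumr_ge0 => i _; rewrite exprn_ge0.
rewrite !big_mkord; apply: ler_sum => i _.
by rewrite /ar1_mx leq_addl addnK normrX.
Qed.

Definition ar1_lin n u i := \sum_(k < n) ar1_mx i k * u k.

Lemma ar1_lin_norm n u :
  \sum_(i < n) ar1_lin n u i ^+ 2 <= r ^+ 2 * \sum_(k < n) u k ^+ 2.
Proof.
apply: (@schur_test _ n ar1_mx) => // i _; first exact: ar1_mx_row_sum.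
exact: ar1_mx_col_sum.
Qed.

Lemma ar1_adj_norm n u :
  \sum_(k < n) (\sum_(i < n) ar1_mx i k * u i) ^+ 2 <= r ^+ 2 * \sum_(k < n) u k ^+ 2.
Proof.
apply: (@schur_test _ n (fun k i => ar1_mx i k)) => // i _; first exact: ar1_mx_col_sum.
exact: ar1_mx_row_sum.
Qed.

Lemma sum_colsum n u : \sum_(k < n) ar1_colsum n k * u k = \sum_(i < n) ar1_lin n u i.
Proof.
rewrite /ar1_lin exchange_big /=; apply: eq_bigr => k _.
by rewrite /ar1_colsum mulr_suml.
Qed.

Lemma sum_gram n u k :
  \sum_(l < n) ar1_gram n k l * u l = \sum_(i < n) ar1_mx i k * ar1_lin n u i.
Proof.
rewrite /ar1_gram; under eq_bigr do rewrite mulr_suml.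
rewrite exchange_big /=; apply: eq_bigr => i _; rewrite /ar1_lin mulr_sumr.
by apply: eq_bigr => l _; rewrite mulrA.
Qed.

(** The factorization A = L^T P L in action: apply L, subtract the mean, apply L^T. Both the
    bilinear form and the operator norm of A are read off from it. *)
Lemma cov_mx_lin n u k :
  \sum_(l < n) cov_mx n k l * u l =
  \sum_(i < n) ar1_mx i k * (ar1_lin n u i - (\sum_(j < n) ar1_lin n u j) / n%:R).
Proof.
under [RHS]eq_bigr do rewrite mulrBr.
rewrite sumrB -sum_gram -mulr_suml -/(ar1_colsum n k) -sum_colsum.
under eq_bigr do rewrite /cov_mx mulrBl.
rewrite sumrB; congr (_ - _).
rewrite [X in _ * X]mulr_suml mulr_sumr; apply: eq_bigr => l _.
by rewrite !mulrA mulrAC.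
Qed.

Lemma cov_mx_form n x y :
  \sum_(k < n) (\sum_(l < n) cov_mx n k l * x l) * y k =
  \sum_(i < n) ar1_lin n x i * ar1_lin n y i -
  (\sum_(i < n) ar1_lin n x i) * (\sum_(i < n) ar1_lin n y i) / n%:R.
Proof.
under eq_bigr do rewrite cov_mx_lin mulr_suml.
rewrite exchange_big /=.
transitivity (\sum_(i < n) (ar1_lin n x i - (\sum_(j < n) ar1_lin n x j) / n%:R)
   * ar1_lin n y i).
  apply: eq_bigr => i _; rewrite /ar1_lin [in RHS]mulr_sumr.
  by apply: eq_bigr => k _; rewrite mulrAC mulrC.
under [LHS]eq_bigr do rewrite mulrBl.
by rewrite sumrB -mulr_sumr mulrAC.
Qed.

Lemma sum_sqr_center n x :
  \sum_(i < n) (x i - (\sum_(j < n) x j) / n%:R) ^+ 2 <= \sum_(i < n) x i ^+ 2.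
Proof.
case: n => [|n]; first by rewrite !big_ord0.
move SE : (\sum_(j < n.+1) x j) => S.
have -> : \sum_(i < n.+1) (x i - S / n.+1%:R) ^+ 2 =
    \sum_(i < n.+1) x i ^+ 2 - S ^+ 2 / n.+1%:R.
  rewrite (eq_bigr (fun i : 'I_n.+1 =>
      x i ^+ 2 - 2 * (S / n.+1%:R) * x i + (S / n.+1%:R) ^+ 2)); last first.
    by move=> i _; ring.
  rewrite big_split sumrB /= -mulr_sumr SE sumr_const card_ord -mulr_natr; field.
  by rewrite addrC natr1 pnatr_eq0.
by rewrite gerBl divr_ge0 ?sqr_ge0.
Qed.

(** L and L^T have norm at most [r] by the Schur test, and the centering P is a contraction. *)
Lemma cov_mx_norm n u :
  \sum_(k < n) (\sum_(l < n) cov_mx n k l * u l) ^+ 2 <=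
  r ^+ 4 * \sum_(k < n) u k ^+ 2.
Proof.
under eq_bigr do rewrite cov_mx_lin.
apply: (le_trans (ar1_adj_norm n (fun i =>
  ar1_lin n u i - (\sum_(j < n) ar1_lin n u j) / n%:R))).
rewrite (_ : r ^+ 4 = r ^+ 2 * r ^+ 2); last by rewrite -exprD.
rewrite -mulrA ler_pM2l ?exprn_gt0//.
exact: (le_trans (sum_sqr_center n (ar1_lin n u))) (ar1_lin_norm n u).
Qed.

End ar1_matrix.

(** * Trace and Hilbert-Schmidt norm of the covariance matrix *)

Section ar1_traces.
Context (R : realFieldType) (al : R).
Hypothesis al1 : `|al| < 1.
Implicit Types (n i j k l : nat) (u x y : nat -> R).
Local Notation q := (al ^+ 2).
Local Notation v := (1 - al ^+ 2).
Local Notation r := (1 - `|al|)^-1.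
Local Notation L := (ar1_mx al).
Local Notation G := (ar1_gram al).
Local Notation w := (ar1_colsum al).
Local Notation A := (cov_mx al).

Let r0 : 0 < r. Proof. by rewrite invr_gt0 subr_gt0. Qed.
Let q0 : 0 <= q. Proof. exact: sqr_ge0. Qed.
Let q1 : q < 1. Proof. by move: al1; rewrite ltr_norml => /andP[h1 h2]; nra. Qed.
Let v0 : 0 < v. Proof. by rewrite subr_gt0. Qed.

(** As v = (1 - |al|)(1 + |al|), the operator bounds can be expressed in powers of v, the scale in
    which [tau] is given. *)
Lemma ar1_row_gain : r <= 2 / v.
Proof.
have a0 : 0 <= `|al| < 1 by rewrite normr_ge0 al1.
have qE : q = `|al| ^+ 2 by rewrite real_normK// num_real.
move: `|al| a0 qE => a /andP[a0 a1] qE.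
have e : v = (1 - a) * (1 + a) by rewrite qE; ring.
have h : 0 < 1 - a by rewrite subr_gt0.
have h' : 0 < 1 + a by lra.
rewrite e invfM mulrCA; apply: ler_peMr; first by rewrite invr_ge0 ltW.
by rewrite ler_pdivlMr// mul1r; lra.
Qed.

Lemma ar1_row_gain2 : r ^+ 2 <= 4 / v ^+ 2.
Proof.
rewrite (_ : 4 / v ^+ 2 = (2 / v) ^+ 2); last by field; rewrite gt_eqF.
rewrite lerXn2r ?nnegrE ?ar1_row_gain//; first exact: ltW.
by rewrite divr_ge0// ltW.
Qed.

(** The covariance of the path at times [i.+1] and [j.+1], an entry of L L^T. The term in [q] is the
    transient due to the start at 0. *)
Definition ar1_cov i j : R := if (j <= i)%N then al ^+ (i - j) * (1 - q ^+ j.+1) / v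
  else al ^+ (j - i) * (1 - q ^+ i.+1) / v.

Lemma ar1_covC i j : ar1_cov i j = ar1_cov j i.
Proof. by rewrite /ar1_cov; case: (ltngtP i j) => // ->. Qed.

Lemma sum_ar1_mx n i j : (i < n)%N -> (j < n)%N ->
  \sum_(k < n) L i k * L j k = ar1_cov i j.
Proof.
wlog ji : i j / (j <= i)%N => [H|] iN jN.
  case: (leqP j i) => [|/ltnW] h; first exact: H.
  by rewrite ar1_covC -H//; apply: eq_bigr => k _; rewrite mulrC.
rewrite /ar1_cov ji.
rewrite -(big_mkord xpredT (fun k => L i k * L j k)).
rewrite (big_cat_nat (n := j.+1))//= [X in _ + X]big_nat [X in _ + X]big1 ?addr0; last first.
  by move=> k /andP[jk _]; rewrite /ar1_mx (leqNgt k j) jk mulr0.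
rewrite big_mkord -(sum_geo q) [v * _]mulrC mulrA mulfK ?gt_eqF// mulr_sumr.
rewrite [RHS](reindex_inj rev_ord_inj) /=; apply: eq_bigr => k _.
have kj : (k <= j)%N by rewrite -ltnS.
rewrite /ar1_mx kj (leq_trans kj ji) -exprM -!exprD subSS.
by congr (_ ^+ _); lia.
Qed.

(** L^T L and L L^T have the same Hilbert-Schmidt norm, and only the latter has entries in closed
    form independent of [n]. *)
Lemma gram_sqr_sum n :
  \sum_(k < n) \sum_(l < n) G n k l ^+ 2 =
  \sum_(i < n) \sum_(j < n) ar1_cov i j ^+ 2.
Proof.
have H1 : forall k l : 'I_n, G n k l ^+ 2 =
   \sum_(i < n) \sum_(j < n) (L i k * L j k) * (L i l * L j l).
  move=> k l; rewrite expr2 {1}/ar1_gram mulr_suml; apply: eq_bigr => i _.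
  rewrite /ar1_gram mulr_sumr; apply: eq_bigr => j _; ring.
have H2 : forall i j : 'I_n, ar1_cov i j ^+ 2 =
   \sum_(k < n) \sum_(l < n) (L i k * L j k) * (L i l * L j l).
  move=> i j; rewrite -(@sum_ar1_mx n i j)// expr2 {1}mulr_suml.
  by apply: eq_bigr => k _; rewrite mulr_sumr.
under eq_bigr => k _ do under eq_bigr => l _ do rewrite H1.
under [RHS]eq_bigr => i _ do under eq_bigr => j _ do rewrite H2.
under eq_bigr => k _ do rewrite exchange_big /=.
rewrite exchange_big /=; apply: eq_bigr => i _.
under eq_bigr => k _ do rewrite exchange_big /=.
by rewrite exchange_big.
Qed.

Local Notation HS n := (\sum_(i < n) \sum_(j < n) ar1_cov i j ^+ 2).

Lemma ar1_cov_step n : HS n.+1 = HS n + 2 * \sum_(j < n) ar1_cov n j ^+ 2 + ar1_cov n n ^+ 2.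
Proof.
rewrite big_ord_recr /=; under eq_bigr do rewrite big_ord_recr /=.
have E : \sum_(i < n) ar1_cov i n ^+ 2 = \sum_(i < n) ar1_cov n i ^+ 2.
  by apply: eq_bigr => i _; rewrite ar1_covC.
by rewrite big_split /= big_ord_recr /= E; ring.
Qed.

Lemma ar1_cov_last n j : (j <= n)%N ->
  v ^+ 2 * ar1_cov n j ^+ 2 = q ^+ (n - j) * (1 - q ^+ j.+1) ^+ 2.
Proof.
move=> jn; rewrite /ar1_cov jn [q ^+ (n - j)]exprAC.
move: (q ^+ j.+1) (al ^+ (n - j)) (gt_eqF v0) => X Y; move: v => t t0.
by field; rewrite t0.
Qed.

Lemma sum_geo_rev n : \sum_(j < n) q ^+ (n - j) = q * \sum_(j < n) q ^+ j.
Proof.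
rewrite (reindex_inj rev_ord_inj) /= mulr_sumr; apply: eq_bigr => j _.
by rewrite -exprS; congr (_ ^+ _); have := ltn_ord j; lia.
Qed.

(** Without the transient factors, which are at most 1, a new row and column add at most 2q + v = 1
    + q to the left side. *)
Lemma ar1_cov_upper n : v ^+ 3 * HS n <= n%:R * (1 + q).
Proof.
elim: n => [|n IH]; first by rewrite big_ord0 mulr0 mul0r.
rewrite ar1_cov_step 2!mulrDr -[n.+1%:R]natr1 [leRHS]mulrDl mul1r -addrA lerD//.
have h j : (j <= n)%N -> v ^+ 2 * ar1_cov n j ^+ 2 <= q ^+ (n - j).
  move=> jn; rewrite ar1_cov_last//; apply: ler_piMr; first exact: exprn_ge0.
  have : 0 <= q ^+ j.+1 <= 1 by rewrite exprn_ge0//= exprn_ile1// ltW.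
  by move: (q ^+ j.+1) => X /andP[X0 X1]; nra.
have h1 : v ^+ 2 * \sum_(j < n) ar1_cov n j ^+ 2 <= q * \sum_(j < n) q ^+ j.
  rewrite -sum_geo_rev mulr_sumr; apply: ler_sum => j _; apply: h.
  exact/ltnW.
have h2 := h n (leqnn n); rewrite subnn expr0 in h2.
have h3 : v * \sum_(j < n) q ^+ j <= 1 by rewrite sum_geo gerBl exprn_ge0.
move: h1 h2 h3; rewrite exprSr.
move: (\sum_(j < n) ar1_cov n j ^+ 2) (ar1_cov n n ^+ 2) (\sum_(j < n) q ^+ j) => X Y Z h1 h2 h3.
have h4 := ler_wpM2l (ltW v0) h1; have h5 := ler_wpM2l (ltW v0) h2.
have h6 := ler_wpM2l q0 h3.
by move: h4 h5 h6; rewrite !mulrA; nra.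
Qed.

(* The summand in [q ^+ n] is the invariant that makes the induction exact. *)
Lemma ar1_cov_lower n : n%:R * (1 + q) * v - 6 <= v ^+ 4 * HS n.
Proof.
pose b := 2 * q ^+ 2 + 4 * q; pose a := 4 * q * v.
suff H : n%:R * (1 + q) * v - b + (a * n%:R + b) * q ^+ n <= v ^+ 4 * HS n.
  apply: le_trans H; rewrite -addrA lerD2l.
  have : 0 <= (a * n%:R + b) * q ^+ n.
    apply: mulr_ge0; last exact: exprn_ge0.
    have h1 : 0 <= q * v * n%:R by rewrite mulr_ge0// mulr_ge0// ltW.
    have h2 := mulr_ge0 q0 q0.
    by rewrite /a /b; move: q0 h1 h2; lra.
  have qq := ler_pM q0 q0 (ltW q1) (ltW q1).
  by rewrite /b; move: q1 qq ((_ + b) * _) => h1 h2 X X0; lra.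
elim: n => [|n IH]; first by rewrite big_ord0 expr0 mulr0 !mul0r mulr1 mulr0; lra.
rewrite ar1_cov_step 2!mulrDr.
have h j : (j <= n)%N -> q ^+ (n - j) - 2 * q ^+ n.+1 <= v ^+ 2 * ar1_cov n j ^+ 2.
  move=> jn; rewrite ar1_cov_last//.
  have -> : q ^+ n.+1 = q ^+ (n - j) * q ^+ j.+1 by rewrite -exprD; congr (_ ^+ _); lia.
  have : 0 <= q ^+ (n - j) by rewrite exprn_ge0.
  by move: (q ^+ (n - j)) (q ^+ j.+1) => X Y X0; have := sqr_ge0 Y; nra.
have h1 : q * \sum_(j < n) q ^+ j - 2 * n%:R * q ^+ n.+1 <=
   v ^+ 2 * \sum_(j < n) ar1_cov n j ^+ 2.
  rewrite -sum_geo_rev mulr_sumr.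
  apply: (@le_trans _ _ (\sum_(j < n) (q ^+ (n - j) - 2 * q ^+ n.+1))); last first.
    by apply: ler_sum => j _; apply: h; exact/ltnW.
  by rewrite sumrB sumr_const card_ord -mulr_natr; lra.
have h2 := h n (leqnn n); rewrite subnn expr0 in h2.
have h3 : v * \sum_(j < n) q ^+ j = 1 - q ^+ n by rewrite sum_geo.
have qS : q ^+ n.+1 = q * q ^+ n by rewrite exprS.
rewrite qS -[n.+1%:R]natr1 in h1 h2 *.
move: h1 h2 h3 IH.
move: (HS n) (\sum_(j < n) ar1_cov n j ^+ 2) (ar1_cov n n ^+ 2) (\sum_(j < n) q ^+ j)
  (q ^+ n) n%:R => H X Y Z Qn N h1 h2 h3 IH.
have h4 := ler_wpM2l (ltW (exprn_gt0 2 v0)) h1.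
have h5 := ler_wpM2l (ltW (exprn_gt0 2 v0)) h2.
have h6 : v ^+ 2 * (q * Z) = v * q * (1 - Qn) by rewrite -h3; ring.
rewrite /a /b in IH *.
by move: h4 h5 IH h6; clear; lra.
Qed.

Lemma ar1_colsum_norm n : \sum_(k < n) w n k ^+ 2 <= r ^+ 2 * n%:R.
Proof.
have := ar1_adj_norm al1 n (fun=> 1).
rewrite expr1n sumr_const card_ord; apply: le_trans; rewrite le_eqVlt; apply/orP; left.
by apply/eqP/eq_bigr => k _; congr (_ ^+ _); apply: eq_bigr => i _; rewrite mulr1.
Qed.

Lemma gram_trace n : v * \sum_(k < n) G n k k = n%:R - q * \sum_(i < n) q ^+ i.
Proof.
rewrite exchange_big /= !mulr_sumr.
rewrite -[X in X%:R]card_ord -sum1_card natr_sum -sumrB; apply: eq_bigr => i _.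
rewrite sum_ar1_mx// /ar1_cov leqnn subnn expr0 mul1r -exprS.
by rewrite mulrC divfK// gt_eqF.
Qed.

(** The diagonal of L L^T sums to n/v minus a transient of at most 1/v^2; removing the mean
    subtracts |L^T 1|^2 / n <= 4/v^2. Hence the 5. *)
Lemma cov_mx_trace n : (0 < n)%N ->
  n%:R / v - 5 / v ^+ 2 <= \sum_(k < n) A n k k <= n%:R / v.
Proof.
move=> n0; have nR : 0 < n%:R :> R by rewrite ltr0n.
have W := ar1_colsum_norm n.
have W0 : 0 <= \sum_(k < n) w n k ^+ 2 by apply: sumr_ge0 => k _; exact: sqr_ge0.
have r2 := ar1_row_gain2.
have Wn : (\sum_(k < n) w n k ^+ 2) / n%:R <= 4 / v ^+ 2.
  by rewrite ler_pdivrMr// (le_trans W)// ler_pM2r.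
have Wn0 : 0 <= (\sum_(k < n) w n k ^+ 2) / n%:R by rewrite divr_ge0// ltW.
have E : \sum_(k < n) A n k k = \sum_(k < n) G n k k - (\sum_(k < n) w n k ^+ 2) / n%:R.
  by rewrite mulr_suml -sumrB; apply: eq_bigr => k _; rewrite /cov_mx expr2.
have S0 : 0 <= \sum_(i < n) q ^+ i by apply: sumr_ge0 => i _; exact: exprn_ge0.
have S1 : \sum_(i < n) q ^+ i <= v^-1 by apply: sum_geo_le; rewrite q0.
have T := gram_trace n.
have GE : \sum_(k < n) G n k k = (n%:R - q * \sum_(i < n) q ^+ i) / v.
  by rewrite -T mulrC mulKf// gt_eqF.
rewrite E GE; apply/andP; split.
  have -> : 5 / v ^+ 2 = v^-1 / v + 4 / v ^+ 2 by field; rewrite gt_eqF.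
  have : q * \sum_(i < n) q ^+ i <= v^-1.
    by apply: le_trans S1; apply: ler_piMl => //; exact: ltW.
  rewrite -(ler_pM2r (_ : 0 < v^-1)) ?invr_gt0// mulrBl.
  by move: Wn; lra.
have : 0 <= q * (\sum_(i < n) q ^+ i) / v by apply: divr_ge0; [exact: mulr_ge0|exact: ltW].
by rewrite mulrBl; lra.
Qed.

(** With w = L^T 1 and G = L^T L, A is the rank-one perturbation G - w w^T / n, so its squared norm
    is that of G, minus 2M/n, plus |w|^4 / n^2, where M = w^T G w = |L w|^2. Since |w|^4 <= n M, the
    correction lies between -2M/n and 0, and M/n <= 16/v^4; with the 6 of [ar1_cov_lower] this makes
    38. *)
Lemma cov_mx_sqr_sum n : (0 < n)%N ->
  n%:R * ((1 + q) / v ^+ 3) - 38 / v ^+ 4 <=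
  \sum_(k < n) \sum_(l < n) A n k l ^+ 2 <= n%:R * ((1 + q) / v ^+ 3).
Proof.
move=> n0; have nR : 0 < n%:R :> R by rewrite ltr0n.
have W := ar1_colsum_norm n.
move WE : (\sum_(k < n) w n k ^+ 2) W => W1 W.
have W10 : 0 <= W1 by rewrite -WE; apply: sumr_ge0 => k _; exact: sqr_ge0.
pose M := \sum_(i < n) ar1_lin al n (w n) i ^+ 2.
have M1 : M <= r ^+ 2 * W1 by rewrite -WE; exact: ar1_lin_norm.
(* Here |w|^2 is the sum of the entries of L w, because w = L^T 1. *)
have M2 : W1 ^+ 2 <= n%:R * M.
  rewrite -WE /M; under eq_bigr do rewrite expr2.
  by rewrite sum_colsum; exact: sqr_sum_le.
have ME : \sum_(k < n) (\sum_(l < n) G n k l * w n l) * w n k = M.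
  under eq_bigr do rewrite sum_gram mulr_suml.
  rewrite exchange_big /=; apply: eq_bigr => i _.
  transitivity (ar1_lin al n (w n) i * \sum_(k < n) L i k * w n k); last by [].
  rewrite mulr_sumr; apply: eq_bigr => k _.
  by move: (ar1_lin al n (w n) i) (w n k) => y z; ring.
have E : \sum_(k < n) \sum_(l < n) A n k l ^+ 2 =
    \sum_(k < n) \sum_(l < n) G n k l ^+ 2 - 2 / n%:R * M + W1 ^+ 2 / n%:R ^+ 2.
  rewrite -ME -WE expr2 [in X in _ + X]mulr_suml mulr_sumr mulr_suml -sumrB -big_split /=.
  apply: eq_bigr => k _.
  rewrite [in X in _ + X]mulr_sumr !mulr_suml mulr_sumr -sumrB -big_split /=.
  by apply: eq_bigr => l _; rewrite /cov_mx; field; rewrite gt_eqF.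
rewrite gram_sqr_sum in E.
have U := ar1_cov_upper n; have Lo := ar1_cov_lower n.
have v3 : 0 < v ^+ 3 by rewrite exprn_gt0.
have v4 : 0 < v ^+ 4 by rewrite exprn_gt0.
have W2 : W1 ^+ 2 / n%:R ^+ 2 <= M / n%:R.
  rewrite ler_pdivrMr ?exprn_gt0// (_ : M / n%:R * n%:R ^+ 2 = n%:R * M)//.
  by field; rewrite gt_eqF.
have M0 : 0 <= M / n%:R.
  apply: divr_ge0; last exact: ltW.
  by apply: sumr_ge0 => k _; exact: sqr_ge0.
have W20 : 0 <= W1 ^+ 2 / n%:R ^+ 2 by rewrite divr_ge0// sqr_ge0.
have r2 := ar1_row_gain2.
have M3 : M / n%:R <= 16 / v ^+ 4.
  rewrite ler_pdivrMr//; apply: (le_trans M1).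
  apply: (@le_trans _ _ (r ^+ 2 * (r ^+ 2 * n%:R))).
    by rewrite ler_pM2l ?exprn_gt0.
  rewrite mulrA ler_pM2r// (_ : 16 / v ^+ 4 = 4 / v ^+ 2 * (4 / v ^+ 2)).
    by rewrite ler_pM// exprn_ge0// ltW.
  by field; rewrite gt_eqF.
have U' : HS n <= n%:R * ((1 + q) / v ^+ 3).
  by rewrite mulrA ler_pdivlMr// mulrC.
have Lo' : n%:R * ((1 + q) / v ^+ 3) - 6 / v ^+ 4 <= HS n.
  rewrite (_ : _ - _ = (n%:R * (1 + q) * v - 6) / v ^+ 4).
    by rewrite ler_pdivrMr// [leRHS]mulrC.
  by field; rewrite gt_eqF.
rewrite E; apply/andP; split.
  rewrite (_ : 38 / v ^+ 4 = 6 / v ^+ 4 + 2 * (16 / v ^+ 4)); last first.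
    by rewrite mulrA -mulrDl; congr (_ / _); lra.
  by rewrite (_ : 2 / n%:R * M = 2 * (M / n%:R)); [lra|rewrite mulrAC mulrA].
by rewrite (_ : 2 / n%:R * M = 2 * (M / n%:R)); [lra|rewrite mulrAC mulrA].
Qed.

Definition cov_mx2 n l m : R := \sum_(k < n) A n k l * A n k m.

Lemma cov_mx2C n l m : cov_mx2 n l m = cov_mx2 n m l.
Proof. by apply: eq_bigr => k _; rewrite mulrC. Qed.

Lemma cov_mx2_form n u :
  \sum_(k < n) (\sum_(l < n) A n k l * u l) ^+ 2 =
  \sum_(l < n) \sum_(m < n) cov_mx2 n l m * u l * u m.
Proof.
transitivity (\sum_(k < n) \sum_(l < n) \sum_(m < n) A n k l * A n k m * u l * u m).
  apply: eq_bigr => k _; rewrite expr2 mulr_suml; apply: eq_bigr => l _.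
  by rewrite mulr_sumr; apply: eq_bigr => m _; ring.
rewrite exchange_big /=; apply: eq_bigr => l _.
rewrite exchange_big /=; apply: eq_bigr => m _.
by rewrite /cov_mx2 !mulr_suml.
Qed.

(** The Hilbert-Schmidt norm of A^2 is at most the operator norm of A times its Hilbert-Schmidt
    norm: [cov_mx_norm] is applied to each column of A. *)
Lemma cov_mx2_sqr_sum n :
  \sum_(l < n) \sum_(m < n) cov_mx2 n l m ^+ 2 <=
  16 / v ^+ 4 * \sum_(k < n) \sum_(l < n) A n k l ^+ 2.
Proof.
apply: (@le_trans _ _ (r ^+ 4 * \sum_(k < n) \sum_(l < n) A n k l ^+ 2)).
  rewrite exchange_big /= mulr_sumr; apply: ler_sum => m _.
  have := cov_mx_norm al1 n (fun k => A n k m).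
  rewrite (_ : \sum_(k < n) A n k m ^+ 2 = \sum_(l < n) A n m l ^+ 2); last first.
    by apply: eq_bigr => k _; rewrite cov_mxC.
  apply: le_trans; apply: ler_sum => l _.
  rewrite le_eqVlt; apply/orP; left; apply/eqP; congr (_ ^+ _).
  by apply: eq_bigr => k _; rewrite (cov_mxC _ _ l).
rewrite ler_wpM2r//.
  by apply: sumr_ge0 => k _; apply: sumr_ge0 => l _; exact: sqr_ge0.
rewrite (_ : 16 / v ^+ 4 = (2 / v) ^+ 4); last by field; rewrite gt_eqF.
rewrite lerXn2r ?nnegrE ?ar1_row_gain//; first exact: ltW.
by rewrite divr_ge0// ltW.
Qed.

End ar1_traces.

(** * Couplings and equality of laws *)

Section lipschitz.
Context (R : realType).
Implicit Types f : R -> R.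

Lemma lipschitz1P f : 1.-lipschitz f <-> forall x y, `|f x - f y| <= `|x - y|.
Proof.
split => [h x y|h [x y] _ /=]; last by rewrite mul1r.
by have := h (x, y) (conj I I); rewrite /= mul1r.
Qed.

Lemma lipschitz1_measurable f : (forall x y, `|f x - f y| <= `|x - y|) ->
  measurable_fun setT f.
Proof.
move=> h; apply: continuous_measurable_fun => x.
apply/cvgrPdist_lt => e e0; near=> y; apply: (le_lt_trans (h x y)).
near: y; exact: (@cvgr_dist_lt _ _ _ _ _ id x).
Unshelve. all: by end_near. Qed.

End lipschitz.

Section coupling.
Context (R : realType) (d : measure_display) (T : measurableType d).
Context (P : probability T R).
Implicit Types (f : R -> R) (X Y : T -> R).

(** The common form of the moment estimates: a pointwise bound by two nonnegative terms is
    integrated. A constant [Y] turns it into an affine bound in [X]. *)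
Lemma ge0_integral_le2 (g X Y : T -> R) (a b M N : R) :
  measurable_fun setT g -> measurable_fun setT X -> measurable_fun setT Y ->
  (forall w, 0 <= g w) -> (forall w, 0 <= X w) -> (forall w, 0 <= Y w) ->
  0 <= a -> 0 <= b -> (forall w, g w <= a * X w + b * Y w) ->
  (\int[P]_w (X w)%:E <= M%:E)%E -> (\int[P]_w (Y w)%:E <= N%:E)%E ->
  (\int[P]_w (g w)%:E <= (a * M + b * N)%:E)%E.
Proof.
move=> /measurable_EFinP mg /measurable_EFinP mX /measurable_EFinP mY.
move=> g0 X0 Y0 a0 b0 gXY XM YN.
apply: (@le_trans _ _ (\int[P]_w (a%:E * (X w)%:E + b%:E * (Y w)%:E))%E).
  apply: ge0_le_integral => //.
  - by move=> w _; rewrite lee_fin.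
  - by apply: emeasurable_funD; exact: measurable_funeM.
  - by move=> w _; rewrite -!EFinM -EFinD lee_fin.
rewrite ge0_integralD//; last 4 first.
- by move=> w _; rewrite -EFinM lee_fin mulr_ge0.
- exact: measurable_funeM.
- by move=> w _; rewrite -EFinM lee_fin mulr_ge0.
- exact: measurable_funeM.
rewrite !ge0_integralZl//; last 2 first.
- by move=> w _; rewrite lee_fin.
- by move=> w _; rewrite lee_fin.
by rewrite EFinD !EFinM leeD// lee_wpmul2l// lee_fin.
Qed.

Lemma integral_cst1 : (\int[P]_w (1 : R)%:E = 1%:E)%E.
Proof. by rewrite integral_cst//= probability_setT mule1. Qed.

Lemma integrable_of_sqr X (M : R) : measurable_fun setT X ->
  (\int[P]_w (X w ^+ 2)%:E <= M%:E)%E -> P.-integrable setT (EFin \o X).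
Proof.
move=> mX XM; apply/integrableP; split; first exact/measurable_EFinP.
apply: (@le_lt_trans _ _ (1 * M + 1 * 1)%:E); last exact: ltry.
apply: (@ge0_integral_le2 _ (fun w => X w ^+ 2) (fun=> 1) 1 1 M 1) => //.
- exact: measurableT_comp.
- exact: measurable_funX.
- by move=> w; exact: sqr_ge0.
- move=> w; rewrite -[X w ^+ 2]real_normK ?num_real//.
  by have := sqr_ge0 (`|X w| - 1); have := sqr_ge0 `|X w|; lra.
- by rewrite integral_cst1.
Qed.

Lemma integrable_lipschitz f X : (forall x y, `|f x - f y| <= `|x - y|) ->
  P.-integrable setT (EFin \o X) -> P.-integrable setT (EFin \o (f \o X)).
Proof.
move=> lf iX.
have mX : measurable_fun setT X by exact/measurable_EFinP/(measurable_int P).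
have ig : P.-integrable setT (fun w => (`|f 0|%:E + `|(X w)%:E|)%E).
  apply: integrableD => //; first exact: finite_measure_integrable_cst.
  exact: integrable_abse.
apply: (le_integrable _ _ _ ig) => //.
  by apply/measurable_EFinP; apply: measurableT_comp => //; exact: lipschitz1_measurable.
move=> w _ /=; rewrite lee_fin [leRHS]ger0_norm ?addr_ge0//.
have := lf (X w) 0; rewrite subr0 => h.
by have := ler_normD (f 0) (f (X w) - f 0); rewrite subrKC; lra.
Qed.

(** The easy half of Kantorovich duality: any coupling bounds the Wasserstein distance. *)
Lemma lipschitz_coupling f X Y (e : R) : (forall x y, `|f x - f y| <= `|x - y|) ->
  P.-integrable setT (EFin \o X) -> P.-integrable setT (EFin \o Y) ->
  (\int[P]_w `|X w - Y w|%:E <= e%:E)%E ->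
  (`| \int[P]_w (f (X w))%:E - \int[P]_w (f (Y w))%:E | <= e%:E)%E.
Proof.
move=> lf iX iY XYe.
have iF := integrable_lipschitz lf iX; have iG := integrable_lipschitz lf iY.
rewrite -integralB//; apply: le_trans XYe.
have iFG := integrableB measurableT iF iG.
apply: (le_trans (le_abse_integral _ _ (measurable_int P iFG))) => //.
have mX : measurable_fun setT X by exact/measurable_EFinP/(measurable_int P).
have mY : measurable_fun setT Y by exact/measurable_EFinP/(measurable_int P).
apply: ge0_le_integral => //.
- by apply: measurableT_comp => //; exact: measurable_int iFG.
- by apply/measurable_EFinP/measurableT_comp => //; exact: measurable_funB.
- by move=> w _ /=; rewrite lee_fin.
Qed.

Lemma integral_same_law (d' : measure_display) (T' : measurableType d')
    (Q : probability T' R) f X (Y : T' -> R) :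
  measurable_fun setT X -> measurable_fun setT Y -> measurable_fun setT f ->
  (forall A : set R, measurable A -> P (X @^-1` A) = Q (Y @^-1` A)) ->
  P.-integrable setT (EFin \o (f \o X)) ->
  Q.-integrable setT (EFin \o (f \o Y)) ->
  (\int[P]_w (f (X w))%:E = \int[Q]_w (f (Y w))%:E)%E.
Proof.
move=> mX mY /measurable_EFinP mf XY iX iY.
have h1 := integral_pushforward mX mf iX measurableT.
have h2 := integral_pushforward mY mf iY measurableT.
rewrite !preimage_setT in h1 h2.
transitivity (\int[pushforward P X]_x (f x)%:E)%E; first by rewrite h1.
transitivity (\int[pushforward Q Y]_x (f x)%:E)%E; last by rewrite h2.
by apply: eq_measure_integral => A mA _; exact: XY.
Qed.

Lemma ge0_integral_same_law (d' : measure_display) (T' : measurableType d')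
    (Q : probability T' R) (h : R -> \bar R) X (Y : T' -> R) :
  measurable_fun setT X -> measurable_fun setT Y -> measurable_fun setT h ->
  (forall u, 0 <= h u)%E ->
  (forall A : set R, measurable A -> P (X @^-1` A) = Q (Y @^-1` A)) ->
  (\int[P]_w h (X w) = \int[Q]_w h (Y w))%E.
Proof.
move=> mX mY mh h0 XY.
have h1 := ge0_integral_pushforward mX P measurableT mh (fun u _ => h0 u).
have h2 := ge0_integral_pushforward mY Q measurableT mh (fun u _ => h0 u).
rewrite !preimage_setT in h1 h2.
transitivity (\int[pushforward P X]_x h x)%E; first by rewrite h1.
transitivity (\int[pushforward Q Y]_x h x)%E; last by rewrite h2.
by apply: eq_measure_integral => A mA _; exact: XY.
Qed.

(** The left inverse [psi] makes [phi] injective and carries the sets [B] over to the index type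
    [I], where independence is stated. *)
Lemma mutually_independent_seq (I : choiceType) (X : I -> {RV P >-> R})
    (phi : nat -> I) (psi : I -> nat) :
  cancel phi psi -> mutually_independent X ->
  forall k (B : nat -> set R), (forall i, measurable (B i)) ->
  P (\bigcap_(i < k) (X (phi i) @^-1` B i)) =
  (\prod_(i < k) P (X (phi i) @^-1` B i))%E.
Proof.
move=> phiK indep k B mB.
pose F : {fset I} := seq_fset tt [seq phi i | i <- iota 0 k].
have := indep F (B \o psi) (fun i _ => mB _).
have -> : \bigcap_(i in [set` F]) X i @^-1` (B \o psi) i =
    \bigcap_(i < k) (X (phi i) @^-1` B i).
  apply/seteqP; split => w /= h i /=.
    move=> ik; have := h (phi i); rewrite /= phiK; apply.
    by rewrite seq_fsetE map_f// mem_iota.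
  rewrite seq_fsetE => /mapP[j + ->]; rewrite mem_iota phiK => /andP[_ jk].
  exact: h.
move=> ->; rewrite (perm_big _ (seq_fset_perm _ _)) /= undup_id; last first.
  by rewrite map_inj_uniq ?iota_uniq//; exact: can_inj phiK.
rewrite big_map -[X in iota _ X]subn0 -/(index_iota 0 k) big_mkord.
by apply: eq_bigr => i _; rewrite phiK.
Qed.

End coupling.

(** * Second moments of the empirical covariances *)

Section empirical.
Context (R : realType) (d : measure_display) (T : measurableType d).
Implicit Types (X Y e : nat -> T -> R) (w : T).

Lemma ar1E (al : R) e n i w : (i < n)%N ->
  ar1 al e i.+1 w = ar1_lin al n (fun k => e k w) i.
Proof.
move=> iN.
have H m : ar1 al e m.+1 w = \sum_(k < m.+1) al ^+ (m - k) * e k w.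
  elim: m => [|m IH]; first by rewrite big_ord1 /= mulr0 add0r mul1r.
  rewrite [LHS]/= -/(ar1 al e m.+1 w) IH [in RHS]big_ord_recr /= subnn mul1r mulr_sumr.
  congr (_ + _); apply: eq_bigr => k _.
  by rewrite mulrA -exprS subSn// -ltnS.
rewrite H (big_ord_widen n (fun k => al ^+ (i - k) * e k w))// big_mkcond.
by apply: eq_bigr => k _; rewrite /ar1_mx ltnS; case: ifP; rewrite ?mul0r.
Qed.

Lemma empirical_cov_ar1 (al : R) (x y : nat -> T -> R) n w : (0 < n)%N ->
  n%:R * empirical_cov n (ar1 al x) (ar1 al y) w =
  \sum_(k < n) (\sum_(l < n) cov_mx al n k l * x l w) * y k w.
Proof.
move=> n0; rewrite (cov_mx_form al n (fun k => x k w) (fun k => y k w)).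
rewrite /empirical_cov !big_add1 /= !big_mkord.
have E (z : nat -> T -> R) (i : 'I_n) : ar1 al z i.+1 w = ar1_lin al n (fun k => z k w) i.
  by rewrite (@ar1E al z n).
have S z : \sum_(i < n) ar1 al z i.+1 w = \sum_(i < n) ar1_lin al n (fun k => z k w) i.
  by apply: eq_bigr => i _; rewrite E.
have S2 : \sum_(i < n) ar1 al x i.+1 w * ar1 al y i.+1 w = \sum_(i < n)
    ar1_lin al n (fun k => x k w) i * ar1_lin al n (fun k => y k w) i.
  by apply: eq_bigr => i _; rewrite !E.
rewrite !S S2.
by field; rewrite pnatr_eq0 -lt0n.
Qed.

Lemma empirical_cov_ge0 n X w : 0 <= empirical_cov n X X w.
Proof.
rewrite /empirical_cov !big_add1 /= !big_mkord.
case: n => [|n]; first by rewrite !big_ord0 !mulr0 subr0.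
have := sqr_sum_le n.+1 (fun i => X i.+1 w).
under [X in _ <= _ * X -> _]eq_bigr do rewrite expr2.
have N0 : 0 < n.+1%:R :> R by rewrite ltr0n.
move: (\sum_(i < n.+1) X i.+1 w) (\sum_(i < n.+1) X i.+1 w * X i.+1 w) => S Q h.
rewrite (_ : _ - _ = (n.+1%:R * Q - S ^+ 2) / n.+1%:R ^+ 2).
  by apply: divr_ge0; [rewrite subr_ge0|exact/ltW/exprn_gt0].
by field; rewrite gt_eqF.
Qed.

(* The variance of [X + t Y] is nonnegative for all [t]. *)
Lemma empirical_cov_CS n X Y w :
  empirical_cov n X Y w ^+ 2 <= empirical_cov n X X w * empirical_cov n Y Y w.
Proof.
have H t : empirical_cov n (fun i w => X i w + t * Y i w)
      (fun i w => X i w + t * Y i w) w =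
    empirical_cov n X X w + 2 * t * empirical_cov n X Y w +
    t ^+ 2 * empirical_cov n Y Y w.
  rewrite /empirical_cov.
  have -> : \sum_(1 <= i < n.+1) (X i w + t * Y i w) =
     \sum_(1 <= i < n.+1) X i w + t * \sum_(1 <= i < n.+1) Y i w.
    by rewrite mulr_sumr -big_split.
  have -> : \sum_(1 <= i < n.+1) (X i w + t * Y i w) * (X i w + t * Y i w) =
     \sum_(1 <= i < n.+1) X i w * X i w +
     2 * t * \sum_(1 <= i < n.+1) X i w * Y i w +
     t ^+ 2 * \sum_(1 <= i < n.+1) Y i w * Y i w.
    by rewrite !mulr_sumr -!big_split; apply: eq_bigr => i _ /=; ring.
  by ring.
have H0 t := empirical_cov_ge0 n (fun i w => X i w + t * Y i w) w.
have X0 := empirical_cov_ge0 n X w; have Y0 := empirical_cov_ge0 n Y w.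
move: (empirical_cov n X X w) (empirical_cov n Y Y w) (empirical_cov n X Y w)
  X0 Y0 H => a b c X0 Y0 H.
have {H H0}H t : 0 <= a + 2 * t * c + t ^+ 2 * b by rewrite -H.
have [b0|bn0] := eqVneq b 0.
  have [->|cn0] := eqVneq c 0; first by rewrite expr0n mulr_ge0.
  have := H (- (a + 1) / (2 * c)); rewrite b0 mulr0 addr0.
  rewrite (_ : _ + _ = -1); first by lra.
  by field; rewrite cn0.
have bp : 0 < b by rewrite lt0r bn0.
have := H (- c / b); rewrite (_ : _ + _ = (a * b - c ^+ 2) / b).
  by rewrite pmulr_lge0 ?invr_gt0// subr_ge0.
by field; rewrite bn0.
Qed.

End empirical.

(** * Elementary inequalities for the linearization *)

Section reals.
Context (R : rcfType).
Implicit Types a b y z v : R.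

(** The geometric mean lies between [a] and [b]: below 1 it is nearer to 1 than the smaller of them,
    above 1 nearer than the larger. *)
Lemma geometric_mean_dist a b y : 0 <= a -> 0 <= b -> 0 <= y -> y ^+ 2 = a * b ->
  (1 - y) ^+ 2 <= (1 - a) ^+ 2 + (1 - b) ^+ 2.
Proof.
wlog ab : a b / a <= b => [H|] a0 b0 y0 yE.
  have [ab|/ltW ba] := leP a b; first exact: H.
  by rewrite [leRHS]addrC; apply: H => //; rewrite mulrC.
have ay : a <= y by rewrite -(@ler_sqr _ a y) ?nnegrE// yE expr2 ler_wpM2l.
have yb : y <= b by rewrite -(@ler_sqr _ y b) ?nnegrE// yE expr2 ler_wpM2r.
have [y1|/ltW y1] := leP y 1.
  have : (1 - y) ^+ 2 <= (1 - a) ^+ 2 by nra.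
  by have := sqr_ge0 (1 - b); lra.
have : (1 - y) ^+ 2 <= (1 - b) ^+ 2 by nra.
by have := sqr_ge0 (1 - a); lra.
Qed.

(* If [v S >= 1/2] then [1 / S <= 2 v]; otherwise |z / S| <= 1 and
   |1 - v S| > 1/2, so the error is at most 2 (1 - v S)^2. *)
Lemma corr_linearization v z11 z22 z : 0 < v -> v <= 1 -> 0 <= z11 -> 0 <= z22 ->
  z ^+ 2 <= z11 * z22 ->
  `|z / Num.sqrt (z11 * z22) - v * z| <=
  v * z ^+ 2 + 2 * ((1 - v * z11) ^+ 2 + (1 - v * z22) ^+ 2).
Proof.
move=> v0 v1 z110 z220 zz; set S := Num.sqrt _.
have p0 : 0 <= z11 * z22 by exact: mulr_ge0.
have S2 : S ^+ 2 = z11 * z22 by rewrite sqr_sqrtr.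
have S0 : 0 <= S by exact: sqrtr_ge0.
have zS : `|z| <= S.
  by rewrite -(@ler_sqr _ `|z| S) ?nnegrE// real_normK ?num_real// S2.
have D := @geometric_mean_dist (v * z11) (v * z22) (v * S) (mulr_ge0 (ltW v0) z110)
  (mulr_ge0 (ltW v0) z220) (mulr_ge0 (ltW v0) S0).
have {D}D : (1 - v * S) ^+ 2 <= (1 - v * z11) ^+ 2 + (1 - v * z22) ^+ 2.
  by apply: D; rewrite exprMn S2; ring.
move: ((1 - v * z11) ^+ 2 + (1 - v * z22) ^+ 2) D => D hD.
have D0 : 0 <= D by exact: le_trans (sqr_ge0 _) hD.
have [SE|Sn0] := eqVneq S 0.
  have -> : z = 0 by apply/eqP; rewrite -normr_eq0 eq_le normr_ge0 andbT -SE.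
  by rewrite mul0r mulr0 subr0 normr0 expr0n mulr0 add0r mulr_ge0.
have Sp : 0 < S by rewrite lt0r Sn0.
have -> : `|z / S - v * z| = `|z| / S * `|1 - v * S|.
  rewrite (_ : z / S - v * z = z / S * (1 - v * S)); last by field.
  by rewrite !normrM normfV (ger0_norm S0).
have := hD; rewrite -[X in X <= _ -> _]real_normK ?num_real//.
have z2 : `|z| ^+ 2 = z ^+ 2 by rewrite real_normK ?num_real.
rewrite -z2.
have [h|h] := leP (1 / 2) (v * S).
  have h2 : `|z| / S <= 2 * v * `|z|.
    rewrite ler_pdivrMr//; have := normr_ge0 z; nra.
  have := ler_wpM2r (normr_ge0 (1 - v * S)) h2.
  move: (`|z| / S * `|1 - v * S|) (`|z|) (`|1 - v * S|) => M Z Y hL hY.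
  apply: (le_trans hL).
  have := ler_wpM2l (ltW v0) (sqr_ge0 (Z - Y)); rewrite mulr0.
  by have : v * Y ^+ 2 <= Y ^+ 2; [rewrite ler_piMl// sqr_ge0|lra].
have h2 : `|z| / S <= 1 by rewrite ler_pdivrMr// mul1r.
have hY : 1 / 2 < `|1 - v * S| by rewrite ger0_norm; lra.
have := ler_wpM2r (normr_ge0 (1 - v * S)) h2.
have : 0 <= v * `|z| ^+ 2 by rewrite mulr_ge0 ?sqr_ge0// ltW.
move: (`|z| / S * `|1 - v * S|) (v * `|z| ^+ 2) (`|1 - v * S|) hY => M Z Y hY Z0 hL hD2.
by nra.
Qed.

Lemma sqr_sub_scaled (k x y : R) : 0 <= k ->
  k * (x - y) ^+ 2 <= 2 * k * (y ^+ 2 + x ^+ 2).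
Proof. by move=> k0; have := mulr_ge0 k0 (sqr_ge0 (x + y)); nra. Qed.

Lemma sqrt_sub1_le (x : R) : 0 <= x -> `|Num.sqrt x - 1| <= `|x - 1|.
Proof.
move=> x0; have s0 := sqrtr_ge0 x.
have -> : x - 1 = (Num.sqrt x - 1) * (Num.sqrt x + 1).
  by rewrite -subr_sqr expr1n sqr_sqrtr.
rewrite normrM ler_peMr// ger0_norm; lra.
Qed.

End reals.

Section moments.
Context (R : realType) (d : measure_display) (T : measurableType d).
Context (P : probability T R) (al : R).
Hypothesis al1 : `|al| < 1.
Local Notation q := (al ^+ 2).
Local Notation v := (1 - al ^+ 2).
Local Notation s2 := ((1 + q) / v ^+ 3).
Local Notation A := (cov_mx al).

Let q0 : 0 <= q. Proof. exact: sqr_ge0. Qed.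
Let q1 : q < 1. Proof. by move: al1; rewrite ltr_norml => /andP[h1 h2]; nra. Qed.
Let v0 : 0 < v. Proof. by rewrite subr_gt0. Qed.
Let v1 : v <= 1. Proof. by rewrite gerBl. Qed.

Definition seq_independent (e : nat -> {RV P >-> R}) :=
  forall k (B : nat -> set R), (forall i, measurable (B i)) ->
  P (\bigcap_(i < k) (e i @^-1` B i)) = (\prod_(i < k) P (e i @^-1` B i))%E.

Lemma measurable_ar1_cov n (x y : nat -> {RV P >-> R}) :
  measurable_fun setT (empirical_cov n (ar1 al x) (ar1 al y)).
Proof. by apply: measurable_empirical_cov => i; exact: measurable_ar1. Qed.

(** This exchanges surplus powers of 1/v for [s2], so that the errors stay proportional to [tau]
    uniformly in [al]. *)
Lemma s2_lower : 1 <= v ^+ 3 * s2.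
Proof. by rewrite mulrC divfK ?lerDl// expf_neq0// gt_eqF. Qed.

(** The error splits into the bias of the trace [T1] against n/v and the fluctuation of n Z around
    [T1]. In 21, the fluctuation takes 8 v (1 + q) <= 16 and the squared bias 50/n <= 5, as n >=
    10. *)
Lemma empirical_var_moment (e : nat -> {RV P >-> R}) n : (10 <= n)%N ->
  seq_independent e -> (forall i, normal_rv 0 1 (e i)) ->
  (\int[P]_w ((1 - v * empirical_cov n (ar1 al e) (ar1 al e) w) ^+ 2)%:E <=
   (21 / (v ^+ 2 * n%:R))%:E)%E.
Proof.
move=> n10 ie Ne; have n0 : (0 < n)%N by apply: leq_trans n10.
have nR : 0 < n%:R :> R by rewrite ltr0n.
have nR10 : 10 <= n%:R :> R by rewrite (ler_nat R 10).
have := past_quad_moment ie Ne n (cov_mxC al n).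
set Z := empirical_cov n (ar1 al e) (ar1 al e).
set T1 := \sum_(i < n) A n i i; set H := \sum_(i < n) \sum_(j < n) A n i j ^+ 2.
have ZE w : \sum_(i < n) \sum_(j < n) A n i j * e i w * e j w = n%:R * Z w.
  rewrite empirical_cov_ar1//; apply: eq_bigr => k _; rewrite mulr_suml.
  by apply: eq_bigr => l _; rewrite mulrAC.
under eq_integral do rewrite ZE.
move=> HX.
have mZ : measurable_fun setT Z by exact: measurable_ar1_cov.
have /andP[] := cov_mx_trace al1 n0; rewrite -/T1 => T1l T1u.
have /andP[_] := cov_mx_sqr_sum al1 n0; rewrite -/H => Hu.
have vn0 : 0 <= 2 * v ^+ 2 / n%:R ^+ 2.
  by rewrite divr_ge0 ?exprn_ge0 ?(ltW nR)// mulr_ge0// exprn_ge0// ltW.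
apply: (le_trans (@ge0_integral_le2 R d T P (fun w => (1 - v * Z w) ^+ 2)
  (fun w => (n%:R * Z w - T1) ^+ 2) (fun=> 1)
  (2 * v ^+ 2 / n%:R ^+ 2) (2 * v ^+ 2 / n%:R ^+ 2 * (n%:R / v - T1) ^+ 2)
  (4 * H) 1 _ _ _ _ _ _ _ _ _ _ _)) => //.
- by apply: measurable_funX; apply: measurable_funB => //; exact: measurable_funM.
- by apply: measurable_funX; apply: measurable_funB => //; exact: measurable_funM.
- by move=> w; exact: sqr_ge0.
- by move=> w; exact: sqr_ge0.
- by rewrite mulr_ge0// sqr_ge0.
- move=> w; rewrite mulr1 -mulrDr.
  have -> : 1 - v * Z w = v / n%:R * ((n%:R / v - T1) - (n%:R * Z w - T1)).
    by field; rewrite !gt_eqF.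
  have k0 : 0 <= v ^+ 2 / n%:R ^+ 2 by rewrite divr_ge0 ?exprn_ge0// ltW.
  rewrite exprMn expr_div_n (_ : 2 * v ^+ 2 / n%:R ^+ 2 = 2 * (v ^+ 2 / n%:R ^+ 2)).
    exact: sqr_sub_scaled.
  by rewrite mulrA.
- by rewrite integral_cst1.
rewrite lee_fin mulr1.
have D2 : (n%:R / v - T1) ^+ 2 <= 25 / v ^+ 4.
  rewrite (_ : 25 / v ^+ 4 = (5 / v ^+ 2) ^+ 2); last by field; rewrite gt_eqF.
  have v5 : 0 <= 5 / v ^+ 2 by rewrite divr_ge0// exprn_ge0// ltW.
  by rewrite lerXn2r ?nnegrE//; lra.
apply: (@le_trans _ _ (2 * v ^+ 2 / n%:R ^+ 2 * (4 * (n%:R * s2)) +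
   2 * v ^+ 2 / n%:R ^+ 2 * (25 / v ^+ 4))).
  by rewrite lerD// ler_wpM2l// ler_pM2l.
have -> : 2 * v ^+ 2 / n%:R ^+ 2 * (4 * (n%:R * s2)) +
   2 * v ^+ 2 / n%:R ^+ 2 * (25 / v ^+ 4) =
   (8 * v * (1 + q) + 50 / n%:R) / (v ^+ 2 * n%:R).
  by field; rewrite !gt_eqF.
rewrite ler_pM2r ?invr_gt0 ?mulr_gt0 ?exprn_gt0//.
have : 50 / n%:R <= 5 :> R by rewrite ler_pdivrMr//; lra.
by move: v1 q1 q0; nra.
Qed.

End moments.

(** * The cross-covariance given the first series *)

Section cross_covariance.
Context (R : realType) (d : measure_display) (T : measurableType d).
Context (P : probability T R) (al : R) (xi eta : nat -> {RV P >-> R}).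
Hypothesis al1 : `|al| < 1.
Hypothesis hxi : forall i, normal_rv 0 1 (xi i).
Hypothesis heta : forall i, normal_rv 0 1 (eta i).
Hypothesis hindep : mutually_independent (fun k : nat + nat =>
  match k with inl i => xi i | inr j => eta j end).
Variable n : nat.
Hypothesis n10 : (10 <= n)%N.
Local Notation gam := (@normal_prob R 0 1).
Local Notation RR := (measurableTypeR R).
Local Notation q := (al ^+ 2).
Local Notation v := (1 - al ^+ 2).
Local Notation s2 := ((1 + q) / v ^+ 3).
Local Notation A := (cov_mx al).
Local Notation Zxy := (empirical_cov n (ar1 al xi) (ar1 al eta)).

Let q0 : 0 <= q. Proof. exact: sqr_ge0. Qed.
Let q1 : q < 1. Proof. by move: al1; rewrite ltr_norml => /andP[h1 h2]; nra. Qed.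
Let v0 : 0 < v. Proof. by rewrite subr_gt0. Qed.
Let v1 : v <= 1. Proof. by rewrite gerBl. Qed.
Let s20 : 0 < s2. Proof. by rewrite divr_gt0 ?exprn_gt0// ltr_wpDr. Qed.
Let n0 : (0 < n)%N. Proof. exact: leq_trans n10. Qed.
Let nR : 0 < n%:R :> R. Proof. by rewrite ltr0n. Qed.
Let nR10 : 10 <= n%:R :> R. Proof. by rewrite (ler_nat R 10). Qed.

Lemma xi_independent : seq_independent xi.
Proof.
pose psi (s : nat + nat) := match s with inl i => i | inr _ => 0%N end.
exact: (mutually_independent_seq (phi := inl) (psi := psi) _ hindep).
Qed.

Lemma eta_independent : seq_independent eta.
Proof.
pose psi (s : nat + nat) := match s with inl _ => 0%N | inr j => j end.
exact: (mutually_independent_seq (phi := inr) (psi := psi) _ hindep).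
Qed.

Definition splice (k : nat) : nat + nat := if (k < n)%N then inl k else inr (k - n)%N.

(* The innovations of the first series up to time [n], then all those of the
   second one: the coefficients of [eta] are functions of the past at time [n]. *)
Definition zeta (k : nat) : {RV P >-> R} :=
  match splice k with inl i => xi i | inr j => eta j end.

Lemma zeta_independent : seq_independent zeta.
Proof.
pose psi (s : nat + nat) := match s with inl i => i | inr j => (n + j)%N end.
apply: (mutually_independent_seq (phi := splice) (psi := psi) _ hindep).
by move=> k; rewrite /psi; rewrite /splice; case: ltnP => // nk; rewrite subnKC.
Qed.

Lemma zeta_normal i : normal_rv 0 1 (zeta i).
Proof. by rewrite /zeta; case: splice. Qed.

Lemma zetal i : (i < n)%N -> zeta i = xi i.
Proof. by rewrite /zeta /splice => ->. Qed.

Lemma zetar j : zeta (n + j) = eta j.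
Proof. by rewrite /zeta /splice ltnNge leq_addr /= addKn. Qed.

Definition cross_coef k w : R := \sum_(l < n) A n k l * zeta l w.

(* The variance of [n * Zxy] given the first series. *)
Definition cond_var w : R := \sum_(k < n) cross_coef k w ^+ 2.

Lemma measurable_cross_coef k :
  measurable_fun setT (cross_coef k : g_sigma_algebraType (past zeta n) -> R).
Proof. exact: measurable_past_lin. Qed.

Lemma measurable_cond_var :
  measurable_fun setT (cond_var : g_sigma_algebraType (past zeta n) -> R).
Proof.
by apply: measurable_sum => k; apply: measurable_funX; exact: measurable_cross_coef.
Qed.

Lemma measurable_cond_varT : measurable_fun setT cond_var.
Proof. exact: (measurableT_comp measurable_cond_var (@measurable_past_id _ _ _ _ zeta n)). Qed.

Lemma cond_var_ge0 w : 0 <= cond_var w.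
Proof. by apply: sumr_ge0 => k _; exact: sqr_ge0. Qed.

Lemma empirical_cross_cov w :
  n%:R * Zxy w = \sum_(k < n) cross_coef k w * zeta (n + k)%N w.
Proof.
rewrite empirical_cov_ar1//; apply: eq_bigr => k _; rewrite zetar; congr (_ * _).
by apply: eq_bigr => l _; rewrite zetal.
Qed.

Lemma cond_var_mean :
  (\int[P]_w (cond_var w)%:E <= (n%:R * s2)%:E)%E.
Proof.
have /andP[_ H] := cov_mx_sqr_sum al1 n0.
apply: (@le_trans _ _ (\sum_(k < n) \sum_(l < n) A n k l ^+ 2)%:E); last by rewrite lee_fin.
under eq_integral do rewrite /cond_var -sumEFin.
rewrite ge0_integral_sum//; last 2 first.
- move=> k; apply: measurable_sqr_fin.
  exact: (measurableT_comp (@measurable_cross_coef k) (@measurable_past_id _ _ _ _ zeta n)).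
- by move=> k w _; rewrite lee_fin sqr_ge0.
rewrite -sumEFin; apply: lee_sum => k _.
exact: (past_lin_moment zeta_independent zeta_normal (A n k) n).
Qed.

Lemma cross_cov_law (h : R -> \bar R) : measurable_fun [set: R] h ->
  (forall u, 0 <= h u)%E ->
  (\int[P]_w h (n%:R * Zxy w)%R =
   \int[P]_w \int[gam]_z h (Num.sqrt (cond_var w) * z)%R)%E.
Proof.
move=> mh h0.
have mh2 : measurable_fun setT (fun p : g_sigma_algebraType (past zeta n) * RR => h p.2).
  by apply: (measurableT_comp mh); exact: measurable_snd.
have := past_gauss_mix zeta_independent zeta_normal measurable_cross_coef n mh2
  (fun p => h0 _).
by under [X in X = _ -> _]eq_integral do rewrite -empirical_cross_cov.
Qed.

Lemma cross_cov_moment : (\int[P]_w (Zxy w ^+ 2)%:E <= (s2 / n%:R)%:E)%E.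
Proof.
have m2 : measurable_fun [set: R] (fun u : R => (u ^+ 2)%:E).
  by apply/measurable_EFinP; exact: measurable_funX.
have H : (\int[P]_w ((n%:R * Zxy w) ^+ 2)%:E <= (n%:R * s2)%:E)%E.
  rewrite (cross_cov_law m2) => [|u]; last by rewrite lee_fin sqr_ge0.
  apply: le_trans cond_var_mean; apply: ge0_le_integral => //.
  - by move=> w _; apply: integral_ge0 => z _; rewrite lee_fin sqr_ge0.
  - pose f (p : T * RR) := ((Num.sqrt (cond_var p.1) * p.2) ^+ 2)%:E.
    apply: (@measurable_fun_fubini_tonelli_F _ _ _ _ R gam f) => [|p]; last first.
      by rewrite lee_fin sqr_ge0.
    apply: measurable_sqr_fin; apply: measurable_funM; last exact: measurable_snd.
    apply: (@measurableT_comp _ _ _ _ _ _ (@Num.sqrt R)).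
      by apply: continuous_measurable_fun => x; exact: sqrt_continuous.
    by apply: (measurableT_comp measurable_cond_varT); exact: measurable_fst.
  - exact/measurable_EFinP/measurable_cond_varT.
  (* Only the linear term is present. Its coefficient is twice [l], hence the half, and the bound
     [4 * l ^+ 2] becomes [cond_var w]. *)
  - move=> w _; have := integral_gauss_quadratic 0 (Num.sqrt (cond_var w) / 2) 0.
    rewrite !expr0n /= mulr0 !addr0 add0r.
    under eq_integral do rewrite mul0r addr0 add0r mulrCA divff// mulr1.
    by rewrite expr_div_n sqr_sqrtr ?cond_var_ge0// mulrCA (_ : 4 / _ = 1) ?mulr1//; field.
have mZ : measurable_fun setT Zxy by exact: measurable_ar1_cov.
apply: (le_trans (@ge0_integral_le2 _ _ _ P (fun w => Zxy w ^+ 2)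
  (fun w => (n%:R * Zxy w) ^+ 2) (fun=> 0) (n%:R ^- 2) 0 (n%:R * s2) 0
  _ _ _ _ _ _ _ _ _ _ _)) => //.
- by apply: measurable_funX.
- by apply: measurable_funX; exact: measurable_funM.
- by move=> w; exact: sqr_ge0.
- by move=> w; exact: sqr_ge0.
- by move=> w; rewrite mulr0 addr0 exprMn mulrA mulVf ?mul1r// expf_neq0// gt_eqF.
- by rewrite integral0.
- by rewrite lee_fin mulr0 addr0 le_eqVlt; apply/orP; left; apply/eqP; field; rewrite !gt_eqF.
Qed.

(** [cond_var] is the quadratic form of A^T A, whose trace is the squared Hilbert-Schmidt norm [H]
    of A. The fluctuation around [H] contributes 128, the bias of [H] against n s2 contributes 2 *
    38^2 / n <= 289; the remaining 1/v^2 is at most [s2]. *)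
Lemma cond_var_moment :
  (\int[P]_w ((cond_var w / (n%:R * s2) - 1) ^+ 2)%:E <= (417 * s2 / n%:R)%:E)%E.
Proof.
have := past_quad_moment zeta_independent zeta_normal n (cov_mx2C al n).
under eq_integral => w _ do rewrite -(cov_mx2_form al n (fun k => zeta k w)) -/(cond_var w).
set T2 := \sum_(i < n) cov_mx2 al n i i.
set B := \sum_(i < n) \sum_(j < n) cov_mx2 al n i j ^+ 2 => HX.
pose H := \sum_(k < n) \sum_(l < n) A n k l ^+ 2.
have TE : T2 = H.
  rewrite /T2 /cov_mx2 exchange_big /=; apply: eq_bigr => k _.
  by apply: eq_bigr => l _; rewrite expr2.
have BH : B <= 16 / v ^+ 4 * H by exact: cov_mx2_sqr_sum.
have /andP[Hl Hu] := cov_mx_sqr_sum al1 n0; rewrite -/H in Hl Hu.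
rewrite TE in HX.
have N0 : 0 < n%:R * s2 by rewrite mulr_gt0.
pose k := (n%:R * s2) ^- 2.
have k0 : 0 < k by rewrite invr_gt0 exprn_gt0.
have mV := measurable_cond_varT.
apply: (le_trans (@ge0_integral_le2 R d T P (fun w => (cond_var w / (n%:R * s2) - 1) ^+ 2)
  (fun w => (cond_var w - H) ^+ 2) (fun=> 1)
  (2 * k) (2 * k * (n%:R * s2 - H) ^+ 2)
  (4 * B) 1 _ _ _ _ _ _ _ _ _ _ _)) => //.
- by apply: measurable_funX; apply: measurable_funB => //; exact: measurable_funM.
- by apply: measurable_funX; apply: measurable_funB.
- by move=> w; exact: sqr_ge0.
- by move=> w; exact: sqr_ge0.
- by rewrite mulr_ge0// ltW.
- by apply: mulr_ge0; [rewrite mulr_ge0// ltW|exact: sqr_ge0].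
- move=> w; rewrite mulr1 -mulrDr.
  have -> : (cond_var w / (n%:R * s2) - 1) ^+ 2 =
      k * ((n%:R * s2 - H) - (cond_var w - H)) ^+ 2.
    by rewrite /k; field; rewrite !gt_eqF// ltr_wpDr.
  exact: (sqr_sub_scaled _ _ (ltW k0)).
- by rewrite integral_cst1.
rewrite lee_fin mulr1.
have D2 : (n%:R * s2 - H) ^+ 2 <= 1444 / v ^+ 8.
  rewrite (_ : 1444 / v ^+ 8 = (38 / v ^+ 4) ^+ 2); last by field; rewrite gt_eqF.
  have v5 : 0 <= 38 / v ^+ 4 by rewrite divr_ge0// exprn_ge0// ltW.
  by rewrite lerXn2r ?nnegrE//; lra.
have v4 : 0 <= 16 / v ^+ 4 by rewrite divr_ge0// exprn_ge0// ltW.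
apply: (@le_trans _ _ (2 * k * (4 * (16 / v ^+ 4 * (n%:R * s2))) +
   2 * k * (1444 / v ^+ 8))).
  rewrite lerD// ler_pM2l ?mulr_gt0// ler_pM2l//.
  by apply: (le_trans BH); rewrite ler_wpM2l.
have -> : 2 * k * (4 * (16 / v ^+ 4 * (n%:R * s2))) + 2 * k * (1444 / v ^+ 8) =
   (128 * v / (1 + q) + 2888 / n%:R / (1 + q) ^+ 2 ) / v ^+ 2 / n%:R.
  by rewrite /k; field; rewrite !gt_eqF// ltr_wpDr.
rewrite ler_pM2r ?invr_gt0//.
have p1 : 1 <= 1 + q by rewrite lerDl.
have e1 : 128 * v / (1 + q) <= 128.
  by rewrite ler_pdivrMr; [lra|exact: lt_le_trans p1].
have e2 : 2888 / n%:R / (1 + q) ^+ 2 <= 289.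
  rewrite ler_pdivrMr; last by rewrite exprn_gt0// (lt_le_trans _ p1).
  apply: (@le_trans _ _ 289).
    by rewrite ler_pdivrMr//; move: nR10; move: (n%:R : R) => N h; lra.
  by rewrite ler_peMr// exprn_ege1.
rewrite ler_pdivrMr ?exprn_gt0//.
have := s2_lower al1.
have := ler_wpM2r (ltW s20) v1.
have vs : 0 <= v ^+ 2 * s2 by rewrite mulr_ge0 ?(ltW s20)// exprn_ge0// ltW.
have := ler_wpM2l vs v1.
move: s2 e1 e2 => s h1 h2; rewrite !exprS expr0 mulr1.
by nra.
Qed.

End cross_covariance.

(** * Distance to the normal law *)

Section distance.
Context (R : realType) (d : measure_display) (T : measurableType d).
Context (P : probability T R) (al : R) (xi eta : nat -> {RV P >-> R}).
Hypothesis al1 : `|al| < 1.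
Hypothesis hxi : forall i, normal_rv 0 1 (xi i).
Hypothesis heta : forall i, normal_rv 0 1 (eta i).
Hypothesis hindep : mutually_independent (fun k : nat + nat =>
  match k with inl i => xi i | inr j => eta j end).
Variable n : nat.
Hypothesis n10 : (10 <= n)%N.
Local Notation gam := (@normal_prob R 0 1).
Local Notation RR := (measurableTypeR R).
Local Notation q := (al ^+ 2).
Local Notation v := (1 - al ^+ 2).
Local Notation s2 := ((1 + q) / v ^+ 3).
Local Notation tau := (Num.sqrt s2).
Local Notation c := (Num.sqrt (v / (1 + q))).
Local Notation rn := (Num.sqrt (n%:R : R)).
Local Notation Zxy := (empirical_cov n (ar1 al xi) (ar1 al eta)).
Local Notation cvar := (cond_var al xi eta n).
Local Notation kap := ((tau * rn)^-1).

Let q0 : 0 <= q. Proof. exact: sqr_ge0. Qed.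
Let q1 : q < 1. Proof. by move: al1; rewrite ltr_norml => /andP[h1 h2]; nra. Qed.
Let v0 : 0 < v. Proof. by rewrite subr_gt0. Qed.
Let p0 : 0 < 1 + q. Proof. by rewrite ltr_wpDr. Qed.
Let s20 : 0 < s2. Proof. by rewrite divr_gt0 ?exprn_gt0. Qed.
Let n0 : (0 < n)%N. Proof. exact: leq_trans n10. Qed.
Let nR : 0 < (n%:R : R). Proof. by rewrite ltr0n. Qed.
Let tau0 : 0 < tau. Proof. by rewrite sqrtr_gt0. Qed.
Let rn0 : 0 < rn. Proof. by rewrite sqrtr_gt0. Qed.
Let tau2 : tau ^+ 2 = s2. Proof. by rewrite sqr_sqrtr// ltW. Qed.
Let rn2 : rn ^+ 2 = n%:R. Proof. by rewrite sqr_sqrtr// ltW. Qed.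

(** The two normalizations agree: theta is close to v Zxy, so the factor c of theta must satisfy c v
    = 1/tau. *)
Lemma scale_factor : c * tau = v^-1.
Proof.
rewrite -sqrtrM; last by rewrite divr_ge0// ltW.
rewrite (_ : v / (1 + q) * s2 = v^-1 ^+ 2); last by field; rewrite !gt_eqF.
by rewrite sqrtr_sqr ger0_norm// invr_ge0 ltW.
Qed.

(** The original space need not carry a normal variable independent of [cond_var]; the second
    coordinate supplies one. *)
Definition product_gauss : probability (T * RR)%type R := (P \x gam)%E.

Definition mixture (p : T * RR) : R := kap * (Num.sqrt (cvar p.1) * p.2).

Lemma measurable_sqrt_cond_var : measurable_fun setT (fun w => Num.sqrt (cvar w)).
Proof.
apply: (@measurableT_comp _ _ _ _ _ _ (@Num.sqrt R)); last exact: measurable_cond_varT.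
by apply: continuous_measurable_fun => x; exact: sqrt_continuous.
Qed.

Lemma measurable_mixture : measurable_fun setT mixture.
Proof.
apply: measurable_funM => //; apply: measurable_funM; last exact: measurable_snd.
by apply: (measurableT_comp measurable_sqrt_cond_var); exact: measurable_fst.
Qed.

Lemma ge0_integral_mixture (h : R -> \bar R) : measurable_fun [set: R] h ->
  (forall u, 0 <= h u)%E ->
  (\int[P]_w h (kap * (n%:R * Zxy w))%R = \int[product_gauss]_p h (mixture p))%E.
Proof.
move=> mh h0; rewrite /product_gauss fubini_tonelli1; last 2 first.
- by apply: (measurableT_comp mh); exact: measurable_mixture.
- by move=> p; exact: h0.
rewrite (@cross_cov_law _ _ _ _ _ _ _ hxi heta hindep n n10 (fun u => h (kap * u)%R)) => [//||u].
- by apply: (measurableT_comp mh); exact: measurable_funM.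
- exact: h0.
Qed.

Lemma mixture_law (B : set R) : measurable B ->
  P ((fun w => kap * (n%:R * Zxy w)) @^-1` B) = product_gauss (mixture @^-1` B).
Proof.
move=> mB.
have mZ : measurable_fun setT Zxy by exact: measurable_ar1_cov.
have mW : measurable_fun setT (fun w => kap * (n%:R * Zxy w)).
  by do 2 apply: measurable_funM => //.
have mBW : measurable ((fun w => kap * (n%:R * Zxy w)) @^-1` B).
  by rewrite -[X in measurable X]setTI; exact: mW.
have mBM : measurable (mixture @^-1` B).
  by rewrite -[X in measurable X]setTI; exact: measurable_mixture.
have e1 := integral_indic P measurableT mBW.
have e2 := integral_indic product_gauss measurableT mBM.
rewrite !setIT in e1 e2; rewrite -e1 -e2.
have := @ge0_integral_mixture (fun u => (\1_B u)%:E).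
by apply => [|u]; [exact/measurable_EFinP/measurable_indic|rewrite lee_fin].
Qed.

Lemma integral_gauss_sqr : (\int[gam]_y (y ^+ 2)%:E <= 1%:E)%E.
Proof.
have := @integral_gauss_quadratic R 0 (1 / 2) 0.
rewrite (_ : 0 ^+ 2 + 4 * (1 / 2) ^+ 2 + 4 * 0 ^+ 2 = 1 :> R); last by field.
apply: le_trans; rewrite le_eqVlt; apply/orP; left; apply/eqP.
by apply: eq_integral => y _; congr (_ %:E); field.
Qed.

Lemma integrable_mixture : product_gauss.-integrable setT (EFin \o mixture).
Proof.
apply: (@integrable_of_sqr _ _ _ _ _ 1); first exact: measurable_mixture.
have m2 : measurable_fun [set: R] (fun u : R => (u ^+ 2)%:E).
  by apply/measurable_EFinP; exact: measurable_funX.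
rewrite -(ge0_integral_mixture m2) => [|u]; last by rewrite lee_fin sqr_ge0.
have mZ : measurable_fun setT Zxy by exact: measurable_ar1_cov.
apply: (le_trans (@ge0_integral_le2 _ _ _ P (fun w => (kap * (n%:R * Zxy w)) ^+ 2)
  (fun w => Zxy w ^+ 2) (fun=> 0) ((kap * n%:R) ^+ 2) 0 (s2 / n%:R) 0
  _ _ _ _ _ _ _ _ _ _ _)) => //.
- by apply: measurable_funX; do 2 apply: measurable_funM => //.
- by apply: measurable_funX.
- by move=> w; exact: sqr_ge0.
- by move=> w; exact: sqr_ge0.
- by move=> w; rewrite mulr0 addr0 mulrA exprMn.
- exact: (cross_cov_moment al1 hxi heta hindep n10).
- by rewrite integral0.
rewrite lee_fin mulr0 addr0 exprMn exprVn exprMn tau2 rn2.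
rewrite le_eqVlt; apply/orP; left; apply/eqP; field.
by rewrite !gt_eqF.
Qed.

Lemma integrable_gauss_snd :
  product_gauss.-integrable setT (EFin \o (snd : T * RR -> R)).
Proof.
have ms : measurable_fun setT (snd : T * RR -> R) by exact: measurable_snd.
apply: (@integrable_of_sqr _ _ _ _ _ 1); first exact: ms.
rewrite /product_gauss fubini_tonelli1; last 2 first.
- by apply/measurable_EFinP; exact: measurable_funX.
- by move=> p; rewrite lee_fin sqr_ge0.
rewrite /fubini_F /= integral_cst//= probability_setT mule1.
exact: integral_gauss_sqr.
Qed.

(** Both variables use the same normal coordinate, so their difference is (sqrt V - 1) times it, and
    the coordinate integrates to at most 1 in absolute value. *)
Lemma mixture_gauss_dist :
  (\int[product_gauss]_p `|mixture p - p.2|%:E <= (21 * tau / rn)%:E)%E.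
Proof.
have ms : measurable_fun setT (snd : T * RR -> R) by exact: measurable_snd.
have mV := measurable_sqrt_cond_var.
rewrite /product_gauss fubini_tonelli1; last 2 first.
- apply/measurable_EFinP/measurableT_comp => //.
  by apply: measurable_funB => //; exact: measurable_mixture.
- by move=> p; rewrite lee_fin.
rewrite /fubini_F /=.
apply: (@le_trans _ _ (\int[P]_w `|kap * Num.sqrt (cvar w) - 1|%:E)%E).
  apply: ge0_le_integral => //.
  - by move=> w _; apply: integral_ge0 => z _; rewrite lee_fin.
  - pose f (p : T * RR) := (`|mixture p - p.2|%R)%:E.
    apply: (@measurable_fun_fubini_tonelli_F _ _ _ _ R gam f) => [|p]; last by rewrite lee_fin.
    apply/measurable_EFinP/measurableT_comp => //.
    by apply: measurable_funB => //; exact: measurable_mixture.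
  - apply/measurable_EFinP/measurableT_comp => //.
    by apply: measurable_funB => //; exact: measurable_funM.
  - move=> w _; rewrite /mixture /=.
    under eq_integral => z _.
      rewrite mulrA -{2}[z]mul1r -mulrBl normrM EFinM; over.
    rewrite ge0_integralZl//.
    + rewrite -[leRHS]mule1 lee_wpmul2l ?lee_fin//; exact: integral_gauss_norm.
    + by apply/measurable_EFinP; exact: normr_measurable.
have N0 : 0 < n%:R * s2 by rewrite mulr_gt0.
pose V w := cvar w / (n%:R * s2).
have VE w : kap * Num.sqrt (cvar w) = Num.sqrt (V w).
  have SN : Num.sqrt (n%:R * s2) = rn * tau by exact: (sqrtrM _ (ltW nR)).
  rewrite /V [RHS]sqrtrM ?cond_var_ge0// [Num.sqrt (n%:R * s2)^-1]sqrtrV ?(ltW N0)//.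
  by rewrite SN mulrC (mulrC rn).
have mcv : measurable_fun setT cvar by exact: measurable_cond_varT.
have mVV : measurable_fun setT V by exact: measurable_funM.
(* In place of Cauchy-Schwarz: |x| <= x^2 / (2a) + a/2 with a = 20 tau / rn, close to the optimal
   sqrt 417 tau / rn. The outcome 417/40 + 10 is below 21. *)
apply: (le_trans (@ge0_integral_le2 _ _ _ P (fun w => `|kap * Num.sqrt (cvar w) - 1|)
  (fun w => (V w - 1) ^+ 2) (fun=> 1) (rn / (40 * tau)) (10 * tau / rn)
   (417 * s2 / n%:R) 1 _ _ _ _ _ _ _ _ _ _ _)) => //.
- apply: measurableT_comp => //; apply: measurable_funB => //; exact: measurable_funM.
- by apply: measurable_funX; apply: measurable_funB.
- by move=> w; exact: sqr_ge0.
- move=> w; rewrite VE mulr1.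
  apply: (le_trans (sqrt_sub1_le _)); first by rewrite divr_ge0 ?cond_var_ge0// ltW.
  rewrite -[(V w - 1) ^+ 2]real_normK ?num_real//.
  move: (`|V w - 1|) => x.
  rewrite -subr_ge0 (_ : _ - _ = (rn * x - 20 * tau) ^+ 2 / (40 * tau * rn)).
    by rewrite divr_ge0 ?sqr_ge0// mulr_ge0 ?(ltW rn0)// mulr_ge0// ltW.
  by field; rewrite !gt_eqF.
- exact: (cond_var_moment al1 hxi heta hindep n10).
- by rewrite integral_cst1.
have e : 417 * s2 / n%:R = 417 * tau ^+ 2 / rn ^+ 2 by rewrite tau2 rn2.
rewrite lee_fin mulr1 e.
rewrite (_ : rn / (40 * tau) * (417 * tau ^+ 2 / rn ^+ 2) = 417 / 40 * (tau / rn)); last first.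
  by field; rewrite !gt_eqF.
have : 0 < tau / rn by exact: divr_gt0.
by rewrite -!mulrA; lra.
Qed.

End distance.

(** * From the correlation to its linearization and to the normal law *)

Section correlation.
Context (R : realType) (d : measure_display) (T : measurableType d).
Context (P : probability T R) (al : R) (xi eta : nat -> {RV P >-> R}).
Hypothesis al1 : `|al| < 1.
Hypothesis hxi : forall i, normal_rv 0 1 (xi i).
Hypothesis heta : forall i, normal_rv 0 1 (eta i).
Hypothesis hindep : mutually_independent (fun k : nat + nat =>
  match k with inl i => xi i | inr j => eta j end).
Variable n : nat.
Hypothesis n10 : (10 <= n)%N.
Local Notation q := (al ^+ 2).
Local Notation v := (1 - al ^+ 2).
Local Notation s2 := ((1 + q) / v ^+ 3).
Local Notation tau := (Num.sqrt s2).
Local Notation c := (Num.sqrt (v / (1 + q))).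
Local Notation rn := (Num.sqrt (n%:R : R)).
Local Notation Zxx := (empirical_cov n (ar1 al xi) (ar1 al xi)).
Local Notation Zyy := (empirical_cov n (ar1 al eta) (ar1 al eta)).
Local Notation Zxy := (empirical_cov n (ar1 al xi) (ar1 al eta)).
Local Notation kap := ((tau * rn)^-1).
Local Notation theta := (empirical_corr al xi eta n).

Let q0 : 0 <= q. Proof. exact: sqr_ge0. Qed.
Let q1 : q < 1. Proof. by move: al1; rewrite ltr_norml => /andP[h1 h2]; nra. Qed.
Let v0 : 0 < v. Proof. by rewrite subr_gt0. Qed.
Let v1 : v <= 1. Proof. by rewrite gerBl. Qed.
Let p0 : 0 < 1 + q. Proof. by rewrite ltr_wpDr. Qed.
Let s20 : 0 < s2. Proof. by rewrite divr_gt0 ?exprn_gt0. Qed.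
Let n0 : (0 < n)%N. Proof. exact: leq_trans n10. Qed.
Let nR : 0 < (n%:R : R). Proof. by rewrite ltr0n. Qed.
Let tau0 : 0 < tau. Proof. by rewrite sqrtr_gt0. Qed.
Let rn0 : 0 < rn. Proof. by rewrite sqrtr_gt0. Qed.
Let tau2 : tau ^+ 2 = s2. Proof. by rewrite sqr_sqrtr// ltW. Qed.
Let rn2 : rn ^+ 2 = n%:R. Proof. by rewrite sqr_sqrtr// ltW. Qed.
Let c0 : 0 < c. Proof. by rewrite sqrtr_gt0 divr_gt0. Qed.
Let cE : c = (v * tau)^-1.
Proof. by rewrite invfM -(scale_factor al1) mulfK// gt_eqF. Qed.

(** [corr_linearization], scaled by c rn and integrated. The term in Zxy^2 gives 1, the two
    variances give 2 (21 + 21) = 84 after [s2_lower] has absorbed v^-3. *)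
Lemma corr_linear_dist :
  (\int[P]_w `|c * rn * theta w - kap * (n%:R * Zxy w)|%:E <= (85 * tau / rn)%:E)%E.
Proof.
have mxx : measurable_fun setT Zxx by exact: measurable_ar1_cov.
have myy : measurable_fun setT Zyy by exact: measurable_ar1_cov.
have mxy : measurable_fun setT Zxy by exact: measurable_ar1_cov.
have mth : measurable_fun setT theta by exact: measurable_empirical_corr.
pose D w := (1 - v * Zxx w) ^+ 2 + (1 - v * Zyy w) ^+ 2.
have mDx : measurable_fun setT (fun w => (1 - v * Zxx w) ^+ 2).
  by apply: measurable_funX; apply: measurable_funB => //; exact: measurable_funM.
have mDy : measurable_fun setT (fun w => (1 - v * Zyy w) ^+ 2).
  by apply: measurable_funX; apply: measurable_funB => //; exact: measurable_funM.
have mD : measurable_fun setT D by exact: measurable_funD.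
have D0 w : 0 <= D w by rewrite addr_ge0// sqr_ge0.
have DI : (\int[P]_w (D w)%:E <= (1 * (21 / (v ^+ 2 * n%:R)) + 1 * (21 / (v ^+ 2 * n%:R)))%:E)%E.
  apply: (@ge0_integral_le2 _ _ _ P D _ _ 1 1 _ _ mD mDx mDy) => //.
  - by move=> w; exact: sqr_ge0.
  - by move=> w; exact: sqr_ge0.
  - by move=> w; rewrite !mul1r.
  - exact: (empirical_var_moment al1 n10 (xi_independent hindep) hxi).
  - exact: (empirical_var_moment al1 n10 (eta_independent hindep) heta).
apply: (le_trans (@ge0_integral_le2 _ _ _ P
  (fun w => `|c * rn * theta w - kap * (n%:R * Zxy w)|)
  (fun w => Zxy w ^+ 2) D (c * rn * v) (c * rn * 2) (s2 / n%:R) _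
  _ _ mD _ _ D0 _ _ _ _ DI)).
- apply: measurableT_comp => //; apply: measurable_funB; first exact: measurable_funM.
  by do 2 apply: measurable_funM => //.
- exact: measurable_funX.
- by move=> w; exact: normr_ge0.
- by move=> w; exact: sqr_ge0.
- by apply: mulr_ge0; [exact/mulr_ge0; exact: ltW|exact: ltW].
- by apply: mulr_ge0 => //; apply: mulr_ge0; exact: ltW.
- move=> w.
  have kE : kap * n%:R = c * rn * v.
    have -> : kap * n%:R = kap * rn ^+ 2 by rewrite rn2.
    by rewrite cE; field; rewrite !gt_eqF.
  rewrite (mulrA kap) kE -(mulrA (c * rn) v) -mulrBr normrM ger0_norm; last first.
    by apply: mulr_ge0; exact: ltW.
  rewrite -!mulrA -!mulrDr ler_wpM2l ?(ltW c0)// ler_wpM2l ?(ltW rn0)//.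
  exact: (corr_linearization v0 v1 (empirical_cov_ge0 _ _ _) (empirical_cov_ge0 _ _ _)
    (empirical_cov_CS _ _ _ _)).
- exact: (cross_cov_moment al1 hxi heta hindep n10).
rewrite lee_fin.
have e1 : c * rn * v * (s2 / n%:R) = tau / rn.
  have -> : s2 / n%:R = tau ^+ 2 / rn ^+ 2 by rewrite tau2 rn2.
  by rewrite cE; field; rewrite !gt_eqF.
have e2 : c * rn * 2 * (1 * (21 / (v ^+ 2 * n%:R)) + 1 * (21 / (v ^+ 2 * n%:R))) =
    84 * (tau / rn * (v ^+ 3 * tau ^+ 2)^-1).
  have -> : v ^+ 2 * n%:R = v ^+ 2 * rn ^+ 2 by rewrite rn2.
  by rewrite cE; field; rewrite !gt_eqF.
rewrite e1 e2.
have h : (v ^+ 3 * tau ^+ 2)^-1 <= 1.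
  by rewrite tau2 invf_le1 ?s2_lower// mulr_gt0// exprn_gt0.
have t0 : 0 < tau / rn by exact: divr_gt0.
have := ler_wpM2l (ltW t0) h.
by rewrite -[85 * _ / _]mulrA; lra.
Qed.

(** The chain crosses three probability spaces: the correlation is coupled with its linearization on
    [T], the latter shares its law with [mixture], which is coupled with the normal coordinate on
    the product, and that coordinate shares its law with [N]. The two couplings cost 85 and 21. *)
Lemma corr_normal_dist (d' : measure_display) (T' : measurableType d')
    (Q : probability T' R) (N : {RV Q >-> R}) (f : R -> R) :
  normal_rv 0 1 N -> (forall x y, `|f x - f y| <= `|x - y|) ->
  (`| \int[P]_w (f (c * rn * theta w))%:E - \int[Q]_w (f (N w))%:E | <=
   (106 * tau / rn)%:E)%E.
Proof.
move=> NN lf.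
have mf := lipschitz1_measurable lf.
have mxy : measurable_fun setT Zxy by exact: measurable_ar1_cov.
have mth : measurable_fun setT theta by exact: measurable_empirical_corr.
pose W w := kap * (n%:R * Zxy w).
pose Th w := c * rn * theta w.
have mW : measurable_fun setT W by do 2 apply: measurable_funM => //.
have mTh : measurable_fun setT Th by exact: measurable_funM.
have iW : P.-integrable setT (EFin \o W).
  apply: (@integrable_of_sqr _ _ _ _ _ ((kap * n%:R) ^+ 2 * (s2 / n%:R) + 0 * 0)) => //.
  apply: (@ge0_integral_le2 _ _ _ P (fun w => W w ^+ 2)
    (fun w => Zxy w ^+ 2) (fun=> 0) ((kap * n%:R) ^+ 2) 0 (s2 / n%:R) 0) => //.
  - exact: measurable_funX.
  - exact: measurable_funX.
  - by move=> w; exact: sqr_ge0.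
  - by move=> w; exact: sqr_ge0.
  - by move=> w; rewrite mulr0 addr0 /W mulrA exprMn.
  - exact: (cross_cov_moment al1 hxi heta hindep n10).
  - by rewrite integral0.
have iD : P.-integrable setT (EFin \o (fun w => Th w - W w)).
  apply/integrableP; split; first by apply/measurable_EFinP; exact: measurable_funB.
  exact: (le_lt_trans corr_linear_dist (ltry _)).
have iTh : P.-integrable setT (EFin \o Th).
  apply: eq_integrable (integrableD measurableT iD iW) => //.
  by move=> w _ /=; rewrite -EFinD subrK.
have H1 := lipschitz_coupling lf iTh iW corr_linear_dist.
have iM := integrable_mixture al1 hxi heta hindep n10.
have iG := integrable_gauss_snd P.
have H2 := lipschitz_coupling lf iM iG (mixture_gauss_dist al1 hxi heta hindep n10).
have E1 : (\int[P]_w (f (W w))%:E = \int[product_gauss P]_p (f (mixture al xi eta n p))%:E)%E.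
  apply: integral_same_law => //.
  - exact: measurable_mixture.
  - by move=> B mB; exact: (mixture_law al hxi heta hindep n10 mB).
  - exact: integrable_lipschitz.
  - exact: integrable_lipschitz.
have iN : Q.-integrable setT (EFin \o N).
  apply: (@integrable_of_sqr _ _ _ _ _ 1) => //.
  apply: le_trans (integral_gauss_sqr R).
  have m2 : measurable_fun [set: R] (fun y : R => (y ^+ 2)%:E).
    by apply/measurable_EFinP; exact: measurable_funX.
  rewrite le_eqVlt; apply/orP; left; apply/eqP.
  apply: (@ge0_integral_same_law _ _ _ Q _ (measurableTypeR R) (normal_prob 0 1)
    (fun u => (u ^+ 2)%:E) N id (measurable_funP N)
    (@measurable_id _ (measurableTypeR R) setT) m2) => [u|].
    by rewrite lee_fin sqr_ge0.
  exact: NN.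
have E2 : (\int[Q]_w (f (N w))%:E = \int[product_gauss P]_p (f p.2)%:E)%E.
  have ms : measurable_fun setT (snd : T * measurableTypeR R -> R).
    exact: measurable_snd.
  apply: (@integral_same_law _ _ _ Q _ _ (product_gauss P) f N snd) => //.
  - move=> B mB; transitivity (normal_prob 0 1 B); first exact: NN.
    rewrite /product_gauss.
    have -> : (snd : T * measurableTypeR R -> R) @^-1` B = setT `*` B.
      by apply/seteqP; split => [[x y]|[x y]] //= [].
    rewrite [RHS]product_measure1E// -[LHS]mul1e.
    by congr (_ * _)%E; apply/esym; exact: probability_setT.
  - exact: integrable_lipschitz.
  - exact: integrable_lipschitz.
rewrite -E1 -E2 in H2.
have fin1 : (\int[P]_w (f (Th w))%:E \is a fin_num)%E.
  exact: (integrable_fin_num measurableT (integrable_lipschitz lf iTh)).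
have fin2 : (\int[P]_w (f (W w))%:E \is a fin_num)%E.
  exact: (integrable_fin_num measurableT (integrable_lipschitz lf iW)).
have fin3 : (\int[Q]_w (f (N w))%:E \is a fin_num)%E.
  exact: (integrable_fin_num measurableT (integrable_lipschitz lf iN)).
move: H1 H2 fin1 fin2 fin3; rewrite -/(Th _).
move: (integral P setT _) (integral P setT _) (integral Q setT _) => [b||] [a||] [e||]//.
rewrite -!EFinB !abse_EFin !lee_fin => h1 h2 _ _ _.
have := ler_normD (a - b) (b - e); rewrite addrA subrK.
have : 85 * tau / rn + 21 * tau / rn = 106 * tau / rn by field; rewrite gt_eqF.
by lra.
Qed.

End correlation.

(** * From Lipschitz to bounded continuous test functions *)

Section infconv.
Context (R : realType) (f : R -> R) (M : R).
Hypothesis fM : forall x, `|f x| <= M.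

(* The Pasch-Hausdorff envelope: the largest [k]-Lipschitz function below [f]. *)
Definition infconv (k x : R) : R := inf [set f y + k * `|x - y| | y in [set: R]].

Let has_lb k x : 0 <= k -> has_lbound [set f y + k * `|x - y| | y in [set: R]].
Proof.
move=> k0; exists (- M) => _ [y _ <-].
have := fM y; rewrite ler_norml => /andP[h _].
by have := mulr_ge0 k0 (normr_ge0 (x - y)); lra.
Qed.

Lemma infconv_le k x y : 0 <= k -> infconv k x <= f y + k * `|x - y|.
Proof. by move=> k0; apply: ge_inf; [exact: has_lb|exists y]. Qed.

Lemma infconv_ge k x m : (forall y, m <= f y + k * `|x - y|) -> m <= infconv k x.
Proof.
move=> h; apply: lb_le_inf; first by exists (f x + k * `|x - x|); exists x.
by move=> _ [y _ <-]; exact: h.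
Qed.

Lemma infconv_le_fun k x : 0 <= k -> infconv k x <= f x.
Proof. by move=> /(infconv_le x x); rewrite subrr normr0 mulr0 addr0. Qed.

Lemma infconv_bound k x : 0 <= k -> `|infconv k x| <= M.
Proof.
move=> k0; rewrite ler_norml; apply/andP; split.
  apply: infconv_ge => y.
  have := fM y; rewrite ler_norml => /andP[h _].
  by have := mulr_ge0 k0 (normr_ge0 (x - y)); lra.
apply: (le_trans (infconv_le_fun x k0)).
by have := fM x; rewrite ler_norml => /andP[].
Qed.

Lemma infconv_lipschitz k x y : 0 <= k ->
  `|infconv k x - infconv k y| <= k * `|x - y|.
Proof.
move=> k0.
have H a b : infconv k a - infconv k b <= k * `|a - b|.
  rewrite lerBlDr -lerBlDl; apply: infconv_ge => z; rewrite lerBlDl.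
  apply: (le_trans (infconv_le a z k0)).
  rewrite addrCA -mulrDr lerD2l ler_wpM2l//.
  by rewrite -[a - z](subrKA b) ler_normD.
by rewrite ler_norml H andbT lerNl opprB distrC H.
Qed.

(** Points within r of x are controlled by continuity; for farther ones the penalty n |x - y|
    eventually exceeds 2M, the largest possible oscillation of [f]. *)
Lemma infconv_cvg x : {for x, continuous f} ->
  infconv n%:R x @[n --> \oo] --> f x.
Proof.
move=> cf; apply/cvgrPdist_le => e e0.
have M0 : 0 <= M by exact: le_trans (fM 0).
have /cvgrPdist_le /(_ e e0) /nbhs_ballP [r /= r0 hr] := cf.
near=> n.
have nr : 2 * M / r <= n%:R by near: n; exact: nbhs_infty_ger.
rewrite ger0_norm ?subr_ge0 ?infconv_le_fun//.
rewrite lerBlDr -lerBlDl; apply: infconv_ge => y.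
have [xy|xy] := ltP `|x - y| r.
  have := hr y xy; rewrite /= ler_norml => /andP[_ h].
  by have := mulr_ge0 (ler0n R n) (normr_ge0 (x - y)); lra.
have h1 : 2 * M <= n%:R * `|x - y|.
  have -> : 2 * M = 2 * M / r * r by rewrite divfK// gt_eqF.
  by apply: ler_pM => //; [rewrite divr_ge0 ?mulr_ge0//|]; exact: ltW.
have := fM y; rewrite ler_norml => /andP[h2 _].
have := fM x; rewrite ler_norml => /andP[_ h3].
by move: e0; lra.
Unshelve. all: by end_near. Qed.

End infconv.

Section weak_convergence.
Context (R : realType) (d : measure_display) (T : measurableType d).
Context (P : probability T R).
Context (d' : measure_display) (T' : measurableType d') (Q : probability T' R).
Context (X : nat -> {RV P >-> R}) (Y : {RV Q >-> R}).

Lemma bounded_integrable (d0 : measure_display) (S : measurableType d0)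
    (m : probability S R) (g : S -> R) (M : R) : measurable_fun setT g ->
  (forall s, `|g s| <= M) -> m.-integrable setT (EFin \o g).
Proof.
move=> mg gM; apply: measurable_bounded_integrable => //.
  by rewrite -ge0_fin_numE ?fin_num_measure.
exists M; split; first exact: num_real.
by move=> z Mz s _; exact: le_trans (gM s) (ltW Mz).
Qed.

Lemma measurable_lipschitz (k : R) (h : R -> R) : 0 <= k ->
  (forall x y, `|h x - h y| <= k * `|x - y|) -> measurable_fun setT h.
Proof.
(* Dividing by [k + 1] reduces to the 1-Lipschitz case and also covers [k = 0]. *)
move=> k0 hl; have k1 : 0 < k + 1 by lra.
have m1 : measurable_fun setT (fun x => (k + 1)^-1 * h x).
  apply: lipschitz1_measurable => x y.
  rewrite -mulrBr normrM gtr0_norm ?invr_gt0// mulrC ler_pdivrMr// mulrC.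
  by apply: (le_trans (hl x y)); rewrite ler_wpM2r//; lra.
rewrite (_ : h = fun x => (k + 1) * ((k + 1)^-1 * h x)).
  exact: measurable_funM.
by apply/funext => x; rewrite mulVKf// gt_eqF.
Qed.

Hypothesis lipschitz_cvg : forall (k M : R) (h : R -> R), 0 <= k ->
  (forall x y, `|h x - h y| <= k * `|x - y|) -> (forall x, `|h x| <= M) ->
  forall e : R, 0 < e ->
  exists n0, forall n, (n0 <= n)%N ->
  (`| \int[P]_w (h (X n w))%:E - \int[Q]_w (h (Y w))%:E | <= e%:E)%E.

(** Half of weak convergence: dominated convergence fixes an envelope below [f] that loses at most
    e/2 under the limit law, and the Lipschitz hypothesis, applied to that one envelope, costs the
    other e/2. *)
Lemma continuous_lower (f : R -> R) (M e : R) : continuous f ->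
  (forall x, `|f x| <= M) -> 0 < e -> exists n0, forall n, (n0 <= n)%N ->
  \int[Q]_w f (Y w) <= \int[P]_w f (X n w) + e.
Proof.
move=> cf fM e0.
have mf : measurable_fun setT f by exact: continuous_measurable_fun.
have mg k : measurable_fun setT (infconv f k%:R).
  by apply: (@measurable_lipschitz k%:R) => // x y; exact: (infconv_lipschitz fM).
have ifY : Q.-integrable setT (EFin \o (f \o Y)).
  by apply: (@bounded_integrable _ _ _ _ M) => [|w]; [exact: measurableT_comp|exact: fM].
have igY k : Q.-integrable setT (EFin \o (infconv f k%:R \o Y)).
  apply: (@bounded_integrable _ _ _ _ M) => [|w]; first exact: measurableT_comp.
  exact: infconv_bound.
have ifX n : P.-integrable setT (EFin \o (f \o X n)).
  by apply: (@bounded_integrable _ _ _ _ M) => [|w]; [exact: measurableT_comp|exact: fM].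
have igX k n : P.-integrable setT (EFin \o (infconv f k%:R \o X n)).
  apply: (@bounded_integrable _ _ _ _ M) => [|w]; first exact: measurableT_comp.
  exact: infconv_bound.
have e2 : 0 < e / 2 by rewrite divr_gt0.
have hcv w : (infconv f k%:R (Y w))%:E @[k --> \oo] --> (f (Y w))%:E.
  apply: cvg_EFin; first by apply: nearW => k.
  exact: (infconv_cvg fM (cf (Y w))).
have [k hk] : exists k, \int[Q]_w f (Y w) - e / 2 <= \int[Q]_w infconv f k%:R (Y w).
  have [_ _] := @dominated_convergence _ _ _ Q setT measurableT
    (fun k w => (infconv f k%:R (Y w))%:E) (fun w => (f (Y w))%:E) (fun=> M%:E)
    (fun k => measurable_int Q (igY k)) (measurable_int Q ifY)
    (aeW _ (fun w _ => hcv w))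
    (finite_measure_integrable_cst Q M measurableT)
    (aeW _ (fun w k _ => infconv_bound fM (Y w) (ler0n R k))).
  rewrite -(fineK (integrable_fin_num measurableT ifY)) => /fine_cvgP[_].
  move=> /cvgrPdist_le /(_ _ e2) [k _ /(_ k (leqnn k))] /= h.
  exists k; move: h; rewrite ler_norml => /andP[_].
  by rewrite /Rintegral lerBlDr lerBlDl addrC.
have [n0 H] := lipschitz_cvg (ler0n R k) (fun x y => infconv_lipschitz fM x y (ler0n R k))
  (fun x => infconv_bound fM x (ler0n R k)) e2.
exists n0 => n /H.
rewrite -(fineK (integrable_fin_num measurableT (igX k n))).
rewrite -(fineK (integrable_fin_num measurableT (igY k))).
rewrite -EFinB abse_EFin lee_fin ler_norml => /andP[h _].
have h2 : \int[P]_w infconv f k%:R (X n w) <= \int[P]_w f (X n w).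
  apply: (le_Rintegral measurableT (igX k n) (ifX n)) => w _.
  exact: (infconv_le_fun fM).
move: hk h h2; rewrite /Rintegral.
by move: (fine _) (fine _) (fine _) (fine _) => a b c1 d1; lra.
Qed.

(** The lower bound is applied to [f] and to its opposite. *)
Lemma weak_cvg_of_lipschitz : cvg_in_distribution X Y.
Proof.
move=> f cf [M0 [_ /(_ (`|M0| + 1))]].
have -> : M0 < `|M0| + 1 by rewrite (le_lt_trans (ler_norm _))// ltrDl.
move=> /(_ isT) fM'; set M := `|M0| + 1 in fM'.
have fM x : `|f x| <= M by exact: fM'.
have gM x : `|(\- f) x| <= M by rewrite normrN.
have cg : continuous (\- f) by move=> x; apply: continuousN; exact: cf.
have mf : measurable_fun setT f by exact: continuous_measurable_fun.
have ifY : Q.-integrable setT (EFin \o (f \o Y)).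
  by apply: (@bounded_integrable _ _ _ _ M) => [|w]; [exact: measurableT_comp|exact: fM].
have ifX n : P.-integrable setT (EFin \o (f \o X n)).
  by apply: (@bounded_integrable _ _ _ _ M) => [|w]; [exact: measurableT_comp|exact: fM].
rewrite unlock.
rewrite -(fineK (integrable_fin_num measurableT ifY)); apply: cvg_EFin.
  by apply: nearW => n; exact: (integrable_fin_num measurableT (ifX n)).
apply/cvgrPdist_le => e e0.
have [n1 H1] := continuous_lower cf fM e0.
have [n2 H2] := continuous_lower cg gM e0.
near=> n.
have h1 : (n1 <= n)%N by near: n; exact: nbhs_infty_ge.
have h2 : (n2 <= n)%N by near: n; exact: nbhs_infty_ge.
have {}H1 := H1 _ h1; have {}H2 := H2 _ h2.
have NY : \int[Q]_w (\- f) (Y w) = - \int[Q]_w f (Y w).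
  have := RintegralZl (-1) measurableT ifY; rewrite mulN1r => <-.
  by apply: eq_Rintegral => w _; rewrite mulN1r.
have NX : \int[P]_w (\- f) (X n w) = - \int[P]_w f (X n w).
  have := RintegralZl (-1) measurableT (ifX n); rewrite mulN1r => <-.
  by apply: eq_Rintegral => w _; rewrite mulN1r.
rewrite NX NY in H2.
rewrite ler_norml; apply/andP; split; move: H1 H2; rewrite /Rintegral /=.
  by move: (fine _) (fine _) => a b; lra.
by move: (fine _) (fine _) => a b; lra.
Unshelve. all: by end_near. Qed.

End weak_convergence.

(** * The constants of the theorem *)

Section constants.
Context (R : realType) (al : R).
Hypothesis al1 : `|al| < 1.
Local Notation q := (al ^+ 2).
Local Notation v := (1 - al ^+ 2).
Local Notation s2 := ((1 + q) / v ^+ 3).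
Local Notation tau := (Num.sqrt s2).
Local Notation c := (Num.sqrt (v / (1 + q))).

Let q0 : 0 <= q. Proof. exact: sqr_ge0. Qed.
Let q1 : q < 1. Proof. by move: al1; rewrite ltr_norml => /andP[h1 h2]; nra. Qed.
Let v0 : 0 < v. Proof. by rewrite subr_gt0. Qed.
Let p0 : 0 < 1 + q. Proof. by rewrite ltr_wpDr. Qed.
Let s20 : 0 < s2. Proof. by rewrite divr_gt0 ?exprn_gt0. Qed.
Let tau0 : 0 < tau. Proof. by rewrite sqrtr_gt0. Qed.
Let tau2 : tau ^+ 2 = s2. Proof. by rewrite sqr_sqrtr// ltW. Qed.
Let c0 : 0 < c. Proof. by rewrite sqrtr_gt0 divr_gt0. Qed.

Lemma C2_ge0 : 0 <= C2 al.
Proof.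
have a1 : 0 < 1 - al by move: al1; rewrite ltr_norml => /andP[]; lra.
have a2 : 0 < 1 - `|al| by rewrite subr_gt0.
have sup0 : 0 <= sup [set m%:R * al ^+ (2 * m + 2) | m in [set m : nat | (1 <= m)%N]].
  set S := [set _ | _ in _].
  (* [sup] is 0 on a set without supremum; otherwise it dominates the nonnegative term at m = 1. *)
  have [hs|/sup_out ->//] := pselect (has_sup S).
  apply: (@le_trans _ _ (1%:R * al ^+ (2 * 1 + 2))); last first.
    by apply: ub_le_sup; [exact: hs.2|exists 1%N].
  by rewrite mul1r exprn_even_ge0.
rewrite /C2; do 4?apply: addr_ge0.
- by apply: mulr_ge0 => //; rewrite divr_ge0// exprn_ge0// ltW.
- rewrite divr_ge0 ?(exprn_ge0 _ (ltW v0))//.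
  by rewrite addr_ge0 ?exprn_even_ge0// mulr_ge0.
- by apply: divr_ge0 => //; apply: mulr_ge0; [exact: sqr_ge0|exact: ltW].
- apply: divr_ge0; first by rewrite mulr_ge0.
  apply: mulr_ge0; last exact: ltW.
  by apply: mulr_ge0; [exact: ltW|exact: sqr_ge0].
- by rewrite divr_ge0// exprn_ge0// ltW.
Qed.

Lemma C4_ge0 : 0 <= C4 al.
Proof.
rewrite /C4; apply: mulr_ge0; last exact: sqrtr_ge0.
by apply: divr_ge0; [exact/exprn_ge0/ltW|exact: ltW].
Qed.

(** Dropping the nonnegative [C2] leaves 3^4 s2^2 = (3 tau)^4 under the root. *)
Lemma C5_root_ge : 3 * tau <= C5 al `^ (1 / 4).
Proof.
have t3 : 0 <= 3 * tau by rewrite mulr_ge0// ltW.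
rewrite [leLHS](_ : _ = ((3 * tau) ^+ 4) `^ (1 / 4)); last first.
  by rewrite -(powR_mulrn 4 t3) -powRrM mul1r divff ?powRr1// pnatr_eq0.
have h : (3 * tau) ^+ 4 <= C5 al.
  rewrite (_ : (3 * tau) ^+ 4 = 3 ^+ 4 * (tau ^+ 2) ^+ 2); last by ring.
  rewrite tau2 /C5 ler_pM2l ?exprn_gt0//.
  have h : 0 <= C2 al / 10 by rewrite divr_ge0// C2_ge0.
  have h' := ltW s20.
  apply: lerXn2r; rewrite ?nnegrE//; first exact: addr_ge0.
  by rewrite lerDl.
apply: ge0_ler_powR => //; rewrite ?nnegrE ?exprn_ge0//.
by apply: le_trans h; exact: exprn_ge0.
Qed.

Lemma sqrt_2pi_ge : 1 / 2 <= Num.sqrt (2 / pi) :> R.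
Proof.
have p0' := pi_gt0 R; have := pihalf_lt2 R => p2.
have -> : 1 / 2 = Num.sqrt ((1 / 2) ^+ 2) :> R by rewrite sqrtr_sqr ger0_norm.
rewrite ler_sqrt ?divr_ge0 ?(ltW p0')// ler_pdivlMr//.
by move: p2; lra.
Qed.

(** The three factors of [C6] are at least 64 c (from 4 K^4 with K >= 2), 3 tau and v tau; c v tau =
    1 leaves 192 tau. *)
Lemma C6_lower : 192 * tau <= C6 al.
Proof.
have S := sqrt_2pi_ge; have C5t := C5_root_ge; have C20 := C2_ge0.
set K := 2 * Num.sqrt (2 / pi) + 1 : R.
have K2 : 2 <= K by rewrite /K; lra.
have K4 : 16 <= K ^+ 4.
  rewrite (_ : 16 = 2 ^+ 4); last by ring.
  by rewrite lerXn2r ?nnegrE//; lra.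
set F1 := 4 * K ^+ 4 * c + 2 * K ^+ 2 * (v / Num.sqrt (1 + q)).
have F1l : 64 * c <= F1.
  have h1 : 0 <= 2 * K ^+ 2 * (v / Num.sqrt (1 + q)).
    apply: mulr_ge0; first by rewrite mulr_ge0// sqr_ge0.
    by apply: divr_ge0; [exact: ltW|exact: sqrtr_ge0].
  have := ler_wpM2r (ltW c0) K4.
  by rewrite /F1; lra.
set F3 := Num.sqrt (2 * (1 + q) / v + v ^+ 2 * C1 al ^+ 2 / 10 + v ^+ 2 * C2 al / 5).
have h1 : 0 <= (1 + q) / v by apply: divr_ge0; exact: ltW.
have h2 : 0 <= v ^+ 2 * C1 al ^+ 2 / 10.
  by apply: divr_ge0 => //; apply: mulr_ge0; exact: sqr_ge0.
have h3 : 0 <= v ^+ 2 * C2 al / 5.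
  by apply: divr_ge0 => //; apply: mulr_ge0 => //; exact: sqr_ge0.
have F3l : v * tau <= F3.
  rewrite -[v * tau]ger0_norm; last by rewrite mulr_ge0 ?ltW.
  rewrite -sqrtr_sqr ler_sqrt.
    rewrite exprMn tau2 (_ : v ^+ 2 * s2 = (1 + q) / v); last by field; rewrite gt_eqF.
    by rewrite -[2 * _ / _]mulrA; lra.
  by rewrite -[2 * _ / _]mulrA; lra.
have -> : C6 al = F1 * C5 al `^ (1 / 4) * F3 by [].
have -> : 192 * tau = 64 * c * (3 * tau) * (v * tau).
  have h : c * v * tau = 1 by rewrite mulrAC (scale_factor al1) mulVf// gt_eqF.
  transitivity (192 * tau * (c * v * tau)); first by rewrite h mulr1.
  by move: c v tau {h} => x y z; ring.
have t3 : 0 <= 3 * tau by rewrite mulr_ge0// ltW.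
have c64 : 0 <= 64 * c by rewrite mulr_ge0// ltW.
apply: (ler_pM (mulr_ge0 c64 t3) (mulr_ge0 (ltW v0) (ltW tau0)) _ F3l).
exact: (ler_pM c64 t3 F1l C5t).
Qed.

End constants.

(** * Rescaling of normal variables and conclusion *)

Section scaling.
Context (R : realType) (d : measure_display) (T : measurableType d).
Context (P : probability T R).

Lemma normal_rv_scale (s : R) (N : {RV P >-> R}) : 0 < s ->
  normal_rv 0 s N -> normal_rv 0 1 (scale_mfun s^-1 N : {RV P >-> R}).
Proof.
move=> s0 hN B mB.
have sn0 : s != 0 by rewrite gt_eqF.
pose S : R -> R := fun x => x * s^-1.
have mS : measurable_fun setT S by exact: measurable_funM.
have mSB : measurable (S @^-1` B) by rewrite -[X in measurable X]setTI; exact: mS.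
transitivity (distribution P N (S @^-1` B)); first by [].
rewrite hN//.
have e1 := integral_indic (normal_prob 0 s) measurableT mSB.
have e2 := integral_indic (normal_prob 0 1) measurableT mB.
rewrite !setIT in e1 e2; rewrite -e1 -e2.
rewrite -(@ge0_integral_gauss_affine R 0 s (fun x => (\1_(S @^-1` B) x)%:E))//.
- apply: eq_integral => x _; congr (_ %:E).
  rewrite !indicE; congr ((_ : bool)%:R).
  have h : S (0 + s * x) = x by rewrite /S add0r mulrC mulKf.
  by apply/idP/idP; rewrite !inE /= h.
- exact/measurable_EFinP/measurable_indic.
Qed.

End scaling.

Theorem theorem14 (R : realType) (d : measure_display) (T : measurableType d)
  (P : probability T R) (alpha : R) (xi eta : nat -> {RV P >-> R})
  (halpha : `|alpha| < 1)
  (hxi : forall i, normal_rv 0 1 (xi i))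
  (heta : forall i, normal_rv 0 1 (eta i))
  (hindep : mutually_independent (fun k : nat + nat =>
     match k with inl i => xi i | inr j => eta j end)) :
  (forall (n : nat) (d' : measure_display) (T' : measurableType d')
     (Q : probability T' R) (N : {RV Q >-> R}),
     (10 <= n)%N -> normal_rv 0 1 N ->
     (wasserstein (P := P)
        (scale_mfun
           (Num.sqrt ((1 - alpha ^+ 2) / (1 + alpha ^+ 2)) * Num.sqrt n%:R)
           (empirical_corr alpha xi eta n))
        N
      <= ((Num.sqrt (2 / pi) * C4 alpha + C6 alpha) / Num.sqrt n%:R)%:E)%E)
  /\
  (forall (d' : measure_display) (T' : measurableType d')
     (Q : probability T' R) (N : {RV Q >-> R}),
     normal_rv 0 (Num.sqrt ((1 + alpha ^+ 2) / (1 - alpha ^+ 2))) N ->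
     cvg_in_distribution (P := P)
       (fun n => scale_mfun (Num.sqrt n%:R) (empirical_corr alpha xi eta n))
       N).
Proof.
pose tau : R := Num.sqrt ((1 + alpha ^+ 2) / (1 - alpha ^+ 2) ^+ 3).
pose c : R := Num.sqrt ((1 - alpha ^+ 2) / (1 + alpha ^+ 2)).
have q1 : alpha ^+ 2 < 1.
  by move: halpha; rewrite ltr_norml => /andP[h1 h2]; nra.
have v0 : 0 < 1 - alpha ^+ 2 by rewrite subr_gt0.
have p0 : 0 < 1 + alpha ^+ 2 by rewrite ltr_wpDr ?sqr_ge0.
have c0 : 0 < c by rewrite sqrtr_gt0 divr_gt0.
have tau0 : 0 < tau by rewrite sqrtr_gt0 divr_gt0 ?exprn_gt0.
split.
  move=> n d' T' Q N n10 NN; apply: ge_ereal_sup => _ [f /lipschitz1P lf <-].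
  have := corr_normal_dist halpha hxi heta hindep n10 NN lf.
  rewrite unlock /=.
  under [X in (`|X - _|)%E]eq_integral do rewrite mulrC.
  move=> /le_trans; apply; rewrite lee_fin.
  have rn0 : 0 < Num.sqrt (n%:R : R) by rewrite sqrtr_gt0 ltr0n; exact: leq_trans n10.
  rewrite ler_pM2r ?invr_gt0//.
  have h1 := C6_lower halpha.
  have h2 : 0 <= Num.sqrt (2 / pi) * C4 alpha.
    by rewrite mulr_ge0 ?sqrtr_ge0// C4_ge0.
  by rewrite -/tau in h1 *; lra.
move=> d' T' Q N NN; apply: weak_cvg_of_lipschitz => k M h k0 hl hM e e0.
have sE : Num.sqrt ((1 + alpha ^+ 2) / (1 - alpha ^+ 2)) = c^-1.
  rewrite /c -sqrtrV; last by rewrite divr_ge0 ?ltW.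
  by rewrite invf_div.
have NN' : normal_rv 0 1 (scale_mfun c N : {RV Q >-> R}).
  by rewrite -[c]invrK; apply: normal_rv_scale; [rewrite invr_gt0|rewrite -sE].
(* [f] is [h] rescaled in both argument and value so as to be 1-Lipschitz; the added 1 keeps [K]
   positive when [k = 0]. *)
pose K := (k + 1) / c.
have K0 : 0 < K by rewrite divr_gt0//; lra.
pose f (x : R) := K^-1 * h (x / c).
have lf x y : `|f x - f y| <= `|x - y|.
  rewrite -mulrBr normrM gtr0_norm ?invr_gt0// mulrC ler_pdivrMr//.
  apply: (le_trans (hl _ _)); rewrite -mulrBl normrM normfV (gtr0_norm c0).
  rewrite /K mulrCA ler_wpM2l// ler_pM2r ?invr_gt0//; lra.
have hE z : h z = K * f (z * c).
  by rewrite /f mulfK ?gt_eqF// mulrA mulfV ?mul1r// gt_eqF.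
(* Beyond [b], the square root of n exceeds K 106 tau / e, which is what the rate requires to fall
   below e. *)
pose b := (K * 106 * tau / e) ^+ 2.
exists (maxn 10 (Num.bound b)) => n; rewrite geq_max => /andP[n10 nb].
have rn0 : 0 < Num.sqrt (n%:R : R) by rewrite sqrtr_gt0 ltr0n; exact: leq_trans n10.
have bn : K * (106 * tau / Num.sqrt n%:R) <= e.
  have t0 : 0 <= K * 106 * tau / e.
    by apply: divr_ge0; [apply: mulr_ge0; [apply: mulr_ge0|]|] => //; exact: ltW.
  rewrite !mulrA ler_pdivrMr// -ler_pdivrMl// mulrC.
  rewrite -[leLHS]ger0_norm// -sqrtr_sqr ler_sqrt//.
  apply: (le_trans (ltW (archi_boundP (sqr_ge0 (K * 106 * tau / e))))).
  by rewrite ler_nat.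
apply: le_trans (_ : (K * (106 * tau / Num.sqrt n%:R))%:E <= e%:E)%E; last by rewrite lee_fin.
have H := corr_normal_dist halpha hxi heta hindep n10 NN' lf.
have mh : measurable_fun setT h by exact: (measurable_lipschitz k0 hl).
have mf : measurable_fun setT f by exact: (lipschitz1_measurable lf).
have fM x : `|f x| <= K^-1 * M.
  by rewrite normrM gtr0_norm ?invr_gt0// ler_pM2l ?invr_gt0.
have iP : P.-integrable setT
    (EFin \o (fun w => f (c * Num.sqrt n%:R * empirical_corr alpha xi eta n w))).
  apply: (@bounded_integrable _ _ _ _ _ (K^-1 * M)) => [|w]; last exact: fM.
  by apply: (measurableT_comp mf); apply: measurable_funM.
have iQ : Q.-integrable setT (EFin \o (fun w => f ((scale_mfun c N : {RV Q >-> R}) w))).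
  apply: (@bounded_integrable _ _ _ _ _ (K^-1 * M)) => [|w]; last exact: fM.
  exact: (measurableT_comp mf).
have -> : (\int[P]_w (h (scale_mfun (Num.sqrt n%:R) (empirical_corr alpha xi eta n) w))%:E =
  K%:E * \int[P]_w (f (c * Num.sqrt n%:R * empirical_corr alpha xi eta n w)%R)%:E)%E.
  rewrite -integralZl//; apply: eq_integral => w _; rewrite hE EFinM.
  by congr (_ * (f _)%:E)%E => /=; rewrite -mulrA mulrC (mulrC c).
have -> : (\int[Q]_w (h (N w))%:E =
  K%:E * \int[Q]_w (f ((scale_mfun c N : {RV Q >-> R}) w))%:E)%E.
  by rewrite -integralZl//; apply: eq_integral => w _; rewrite hE EFinM.
have finP := integrable_fin_num measurableT iP.
have finQ := integrable_fin_num measurableT iQ.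
rewrite -muleBr ?fin_num_adde_defr// abseM gee0_abs ?lee_fin ?(ltW K0)//.
by rewrite [leRHS]EFinM lee_wpmul2l ?lee_fin ?(ltW K0).
Qed.
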